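(* Let $\bar\mu$ be a translation-invariant product probability measure on $\mathbb N^{\mathbb Z^d}$ whose single site marginal $\mu$ satisfies $\mu(0)>0$. Consider a mass migration zero range process (MM-ZRP) on $\mathbb Z^d$ with rates $p(x,y)g^k_\alpha$ for an asymmetric $p(\cdot,\cdot)$. Assume that either there is $C>0$ with $\sum_{k=1}^\alpha k\,g^k_\alpha\le C(\alpha+\beta)$ for all $\alpha>0,\beta\ge0$ and $\mu$ has a finite first moment, or the alternative assumptions (A1)–(A2) (stated in the context) are satisfied. Then $\bar\mu$ is invariant for the MM-ZRP if and only if $$g^k_{\alpha+k}\,\mu(\alpha+k)=\mu(\alpha)\frac{\mu(k)}{\mu(0)}\,g^k_k\qquad\text{for all }k\ge1,\ \alpha\ge1.$$ If instead $p(\cdot,\cdot)$ is symmetric, then this condition is (only) sufficient for $\bar\mu$ to be invariant.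
   Context: $\mathbb N=\{0,1,2,\dots\}$ and $X=\mathbb Z^d$. Mass migration process (MMP): $p(\cdot,\cdot)$ is an irreducible translation-invariant transition probability on $\mathbb Z^d$ (symmetric if $p(x,y)=p(y,x)$ for all $x,y$, asymmetric otherwise). The rates are numbers $g^k_{\alpha,\beta}\ge0$ with $g^0_{\alpha,\beta}=0$ and $g^k_{\alpha,\beta}=0$ if $k>\alpha$ or $\alpha=0$; $k$ particles jump together from $x$ to $y$ at rate $p(x,y)g^k_{\eta(x),\eta(y)}$. An MM-ZRP is an MMP whose rates do not depend on the arrival site: $g^k_{\alpha,\beta}=g^k_\alpha$. Fix a positive function $a$ on $X$ and $M>0$ with $\sum_yp(x,y)a_y+\sum_ya_yp(y,x)\le Ma_x$ for all $x$, and $\sum_xa_x<\infty$. Set $\|\eta\|=\sum_x\eta(x)a_x$, $\|\eta-\zeta\|=\sum_x|\eta(x)-\zeta(x)|a_x$, $\mathfrak X=\{\eta\in\mathbb N^X:\|\eta\|<\infty\}$, and let $\mathbf L$ be the set of $f:\mathfrak X\to\mathbb R$ such that $|f(\eta)-f(\zeta)|\le L_f\|\eta-\zeta\|$ for some $L_f>0$. Generator: $\mathcal Lf(\eta)=\sum_{x,y}\sum_{k>0}p(x,y)g^k_{\eta(x),\eta(y)}\big(f(\mathcal S^k_{x,y}\eta)-f(\eta)\big)$, where $\mathcal S^k_{x,y}\eta$ is $\eta$ with $k$ particles moved from $x$ to $y$ if $\eta(x)\ge k$ and $x\neq y$, and $\eta$ otherwise. The process is assumed constructed, i.e. there is a Markov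 semigroup $(S(t))_{t\ge0}$ on $\mathbf L$ such that for $f\in\mathbf L$, $\eta\in\mathfrak X$: $S(t_1+t_2)=S(t_1)S(t_2)$, $S(0)=I$; $S(t)f(\eta)=f(\eta)+\int_0^t\mathcal LS(s)f(\eta)\,ds$; $|S(t)f(\eta)-f(\eta)|\le\|\eta\|L_f(e^{ct}-1)$ for a constant $c>0$; $S(t)f(\eta)$ and $\mathcal LS(t)f(\eta)$ are continuous in $t$; $\lim_{t\searrow0}(S(t)f(\eta)-f(\eta))/t=\mathcal Lf(\eta)$; $\mathcal LS(t)f(\eta)=S(t)\mathcal Lf(\eta)$. (Under (A1) below another construction of the semigroup is allowed.) A probability measure $\bar\mu$ on $\mathbb N^X$ is invariant if it is supported on $\mathfrak X$ and $\int S(t)f\,d\bar\mu=\int f\,d\bar\mu$ for every bounded $f\in\mathbf L$ and $t\ge0$. Alternative assumptions: (A1) a probability measure $\bar\mu$ on $\mathbb N^X$ is called invariant when $\int S(t)f\,d\bar\mu=\int f\,d\bar\mu$ for every bounded $f\in\mathbf L$, $t\ge0$, and this is equivalent to $\int\mathcal Lf\,d\bar\mu=0$ for every bounded cylinder function $f$ on $\mathbb N^X$; (A2) there is $C>0$ with $\sum_{k\le\alpha}g^k_{\alpha,\beta}\le C$ for all $\alpha,\beta$. *)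

(* Defs.v *)
From HB Require Import structures.
From mathcomp Require Import all_boot all_order all_algebra.
From mathcomp Require Import all_classical all_reals all_analysis.

Set Implicit Arguments.
Unset Strict Implicit.
Unset Printing Implicit Defensive.

Import Order.TTheory GRing.Theory Num.Theory.
Import numFieldNormedType.Exports.

Local Open Scope classical_set_scope.
Local Open Scope ring_scope.

Notation lattice d := ('rV[int]_d).

Definition single_site_events (d : nat) : set (set (lattice d -> nat)) :=
  [set A | exists (x : lattice d) (n : nat), A = [set eta | eta x = n]].

(* nat^(Z^d) with its product sigma-algebra; as a type it is convertible to
   lattice d -> nat *)
Notation conf d := (g_sigma_algebraType (@single_site_events d)).

(* Sum of a real family over a (countable) set, the positive and negative parts
   being summed separately: the usual sum when the family is absolutely
   summable, a default value when it is not. *)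
Definition rsum (R : realType) (T : choiceType) (A : set T) (u : T -> R) : R :=
  fine (\esum_(i in A) (EFin \o u)^\+ i - \esum_(i in A) (EFin \o u)^\- i)%E.

Section transition_probabilities.
Variables (R : realType) (d : nat).
Implicit Type p : lattice d -> lattice d -> R.

Definition transition_probability p :=
  (forall x y, 0 <= p x y) /\
  (forall x, \esum_(y in setT) (p x y)%:E = 1%E).

Fixpoint nstep p (n : nat) (x y : lattice d) : \bar R :=
  if n is n'.+1 then \esum_(z in setT) ((p x z)%:E * nstep p n' z y)%E
  else ((x == y)%:R)%:E.

Definition irreducible p := forall x y, exists n, (0 < nstep p n x y)%E.

Definition translation_invariant_kernel p :=
  forall x y z, p (x + z) (y + z) = p x y.

Definition symmetric_kernel p := forall x y, p x y = p y x.

Definition asymmetric_kernel p := ~ symmetric_kernel p.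

End transition_probabilities.

Section weighted_configurations.
Variables (R : realType) (d : nat).
Implicit Types (a : lattice d -> R) (f : conf d -> R).

Definition admissible_weight (p : lattice d -> lattice d -> R) a (M : R) :=
  [/\ 0 < M,
      forall x, 0 < a x,
      forall x, (\esum_(y in setT) (p x y * a y)%:E
                 + \esum_(y in setT) (a y * p y x)%:E <= (M * a x)%:E)%E
    & (\esum_(x in setT) (a x)%:E < +oo)%E].

Definition wnorm a (eta : conf d) : \bar R :=
  \esum_(x in setT) ((eta x)%:R * a x)%:E.

Definition wdist a (eta zeta : conf d) : \bar R :=
  \esum_(x in setT) (`|(eta x)%:R - (zeta x)%:R| * a x)%:E.

Definition finite_norm a : set (conf d) := [set eta | (wnorm a eta < +oo)%E].

(* A function on finite_norm a is represented by a function on all of conf d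
   whose values outside finite_norm a are irrelevant. *)
Definition lipschitz_with a (L : R) f :=
  0 < L /\
  forall eta zeta, finite_norm a eta -> finite_norm a zeta ->
    (`|f eta - f zeta|%:E <= L%:E * wdist a eta zeta)%E.

Definition lip a : set (conf d -> R) := [set f | exists L, lipschitz_with a L f].

Definition bounded_on (E : set (conf d)) f :=
  exists B : R, forall eta, E eta -> `|f eta| <= B.

Definition cylinder f :=
  exists s : seq (lattice d), forall eta zeta : conf d,
    (forall x, x \in s -> eta x = zeta x) -> f eta = f zeta.

End weighted_configurations.

Section mass_migration.
Variables (R : realType) (d : nat).
Implicit Types (p : lattice d -> lattice d -> R) (a : lattice d -> R).
(* g k alpha beta is the rate g^k_{alpha,beta} *)
Implicit Type g : nat -> nat -> nat -> R.
Implicit Type S : R -> (conf d -> R) -> conf d -> R.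

Definition mmp_rates g :=
  [/\ forall k alpha beta, 0 <= g k alpha beta,
      forall alpha beta, g 0%N alpha beta = 0
    & forall k alpha beta,
        (alpha < k)%N \/ alpha = 0%N -> g k alpha beta = 0].

Definition zrp_rates (g : nat -> nat -> R) : nat -> nat -> nat -> R :=
  fun k alpha _ => g k alpha.

Definition linear_growth g :=
  exists2 C : R, 0 < C & forall alpha beta, (0 < alpha)%N ->
    \sum_(1 <= k < alpha.+1) k%:R * g k alpha beta <= C * (alpha + beta)%:R.

Definition bounded_rates g :=
  exists2 C : R, 0 < C & forall alpha beta,
    \sum_(0 <= k < alpha.+1) g k alpha beta <= C.

Definition jump (k : nat) (x y : lattice d) (eta : conf d) : conf d :=
  if (k <= eta x)%N && (x != y) then
    fun z => if z == x then (eta x - k)%N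
             else if z == y then (eta y + k)%N else eta z
  else eta.

Definition generator p g (f : conf d -> R) (eta : conf d) : R :=
  rsum [set i : lattice d * lattice d * nat | (0 < i.2)%N]
    (fun i => let: (x, y, k) := i in
       p x y * g k (eta x) (eta y) * (f (jump k x y eta) - f eta)).

(* A Markov semigroup on a class D of functions on the state space E. *)
Record markov_semigroup (E : set (conf d)) (D : set (conf d -> R)) S : Prop := {
  markov_stable : forall t f, 0 <= t -> D f -> D (S t f);
  markov_linear : forall t c f h eta, 0 <= t -> D f -> D h -> E eta ->
    S t (fun zeta => c * f zeta + h zeta) eta = c * S t f eta + S t h eta;
  markov_unit : forall t eta, 0 <= t -> E eta -> S t (fun=> 1) eta = 1;
  markov_ge0 : forall t f, 0 <= t -> D f -> (forall eta, E eta -> 0 <= f eta) ->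
    forall eta, E eta -> 0 <= S t f eta;
  markov_id : forall f eta, D f -> E eta -> S 0 f eta = f eta;
  markov_add : forall t1 t2 f eta, 0 <= t1 -> 0 <= t2 -> D f -> E eta ->
    S (t1 + t2) f eta = S t1 (S t2 f) eta }.

(* In mmp_comm, generator p g f need not be in lip a: the semigroup is applied
   there to a function outside the class on which it is a Markov semigroup. *)
Record mmp_semigroup p g a S : Prop := {
  mmp_markov : markov_semigroup (finite_norm a) (lip a) S;
  mmp_integral : forall f eta t, lip a f -> finite_norm a eta -> 0 <= t ->
    S t f eta = f eta +
      \int[lebesgue_measure]_(s in `[0, t]) generator p g (S s f) eta;
  mmp_bound : exists2 c : R, 0 < c & forall f L eta t,
    lipschitz_with a L f -> finite_norm a eta -> 0 <= t ->
    (`|S t f eta - f eta|%:E <= wnorm a eta * (L * (expR (c * t) - 1))%:E)%E;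
  mmp_continuous : forall f eta, lip a f -> finite_norm a eta ->
    {within `[0, +oo[, continuous (fun t => S t f eta)};
  mmp_gen_continuous : forall f eta, lip a f -> finite_norm a eta ->
    {within `[0, +oo[, continuous (fun t => generator p g (S t f) eta)};
  mmp_derivative : forall f eta, lip a f -> finite_norm a eta ->
    (S t f eta - f eta) / t @[t --> 0^'+] --> generator p g f eta;
  mmp_comm : forall f eta t, lip a f -> finite_norm a eta -> 0 <= t ->
    generator p g (S t f) eta = S t (generator p g f) eta }.

(* Invariance for a process with state space E, where E is finite_norm a or
   setT.  For E = finite_norm a the first clause says that nu is supported there
   and the measurability clause is automatic, since a Lipschitz function is
   continuous for the separable metric wdist a; for E = setT the first clause
   is vacuous, and measurability has to be asked for off finite_norm a. *)
Definition invariant_measure (E : set (conf d)) a S (nu : probability (conf d) R) :=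
  nu E = 1%E /\
  forall f t, lip a f -> bounded_on E f -> measurable_fun E f -> 0 <= t ->
    (\int[nu]_(eta in E) (S t f eta)%:E = \int[nu]_(eta in E) (f eta)%:E)%E.

(* The semigroup lives on nat^(Z^d) itself and may come from another
   construction: all that is known of its domain D is that it consists of
   measurable functions and contains those tested in the definition of
   invariance. *)
Definition alternative_construction p g a S :=
  exists D : set (conf d -> R),
    [/\ D `<=` [set f | measurable_fun setT f],
        forall f, lip a f -> bounded_on setT f -> measurable_fun setT f -> D f,
        markov_semigroup setT D S
      & forall nu : probability (conf d) R,
          invariant_measure setT a S nu <->
          forall f, bounded_on setT f -> cylinder f ->
            (\int[nu]_eta (generator p g f eta)%:E = 0)%E].

End mass_migration.

Section product_measures.
Variables (R : realType) (d : nat).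
Implicit Types (nu : probability (conf d) R) (mu : nat -> R).

Definition translation_invariant_measure nu :=
  forall (z : lattice d) (A : set (conf d)), measurable A ->
    nu [set eta | A (fun x => eta (x + z))] = nu A.

Definition product_measure_on_sites nu :=
  forall (s : seq (lattice d)) (n : lattice d -> nat), uniq s ->
    nu [set eta | forall x, x \in s -> eta x = n x] =
    (\prod_(x <- s) nu [set eta | eta x = n x])%E.

Definition single_site_marginal nu mu :=
  forall x n, nu [set eta | eta x = n] = (mu n)%:E.

Definition probability_weights mu :=
  (forall n, 0 <= mu n) /\ (\sum_(0 <= n <oo) (mu n)%:E = 1)%E.

Definition finite_first_moment mu :=
  (\sum_(0 <= n <oo) (n%:R * mu n)%:E < +oo)%E.

End product_measures.

(* The two alternative sets of assumptions.  Each one fixes the state space E of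
   the process, hence the meaning of invariance. *)
Definition standing_assumptions (R : realType) (d : nat)
    (p : lattice d -> lattice d -> R) (a : lattice d -> R)
    (g : nat -> nat -> nat -> R) (mu : nat -> R)
    (E : set (conf d)) (S : R -> (conf d -> R) -> conf d -> R) :=
  [/\ E = finite_norm a, mmp_semigroup p g a S,
      linear_growth g & finite_first_moment mu] \/
  [/\ E = setT, alternative_construction p g a S & bounded_rates g].

Definition product_condition (R : realType) (g : nat -> nat -> R) (mu : nat -> R) :=
  forall k alpha : nat, (1 <= k)%N -> (1 <= alpha)%N ->
    g k (alpha + k)%N * mu (alpha + k)%N = mu alpha * (mu k / mu 0%N) * g k k.

(* Main.v *)
Require Import Defs.
From mathcomp Require Import all_boot all_order all_algebra.
From mathcomp Require Import all_classical all_reals all_analysis.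
From mathcomp Require Import measurable_realfun zify ring lra.

(** Under either set of assumptions, invariance of the product measure nu is
    equivalent to: the integral of L f vanishes for every bounded cylinder
    function f, where L is the generator ([invariant_generator]).  On all of
    nat^(Z^d) this is assumed.  For the semigroup on Lipschitz functions it is
    [lipschitz_invariance]: the difference quotients (S_t f - f) / t converge
    to L f and are dominated by a multiple of the weighted norm, which is
    integrable because mu has a first moment; this gives one direction.
    Conversely, restricting a Lipschitz function to finite boxes shows that L f
    has integral zero for bounded Lipschitz f too, so that t |-> int S_t f has
    right derivative zero everywhere and is constant.

    The integral of L f is then computed.  Let k particles jump from x to y.
    Resampling the occupation of x independently ([resample]) turns
    int g^k(eta x) f(S^k_(x,y) eta) into

      sum_n  w(k, n)  int f(eta with n particles at x and k more at y),

    with w(k, n) = g^k_(n+k) mu(n+k), called [flow] below.  If f depends only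
    on the finite set s, a jump from x in s to y outside s contributes an
    amount that does not depend on y, and symmetrically for jumps into s.  As
    p is doubly stochastic, the infinite sum over pairs of sites collapses to
    sums over s ([integral_generator]).

    The product condition says exactly that w(k, n) = mu(n) c(k).  Resampling
    backwards then shows that the loss due to the jumps from x equals the gain
    due to the arrivals at x, and the finite formula telescopes to zero, for
    symmetric and asymmetric p alike ([product_condition_generator]).

    For the converse, the test functions are indicators of {eta u = a} and of
    {eta u = a, eta v = b}.  The former give one balance equation per a; when
    it is substituted in the latter, what remains is
    p(u,v) W(a,b) + p(v,u) W(b,a) = 0, with W not depending on the sites.
    Exchanging a and b and using p(u,v) <> p(v,u) yields W = 0.  Taking b = 0
    and then arguing by induction on the size of the jump gives the product
    condition ([generator_product_condition]).

    For symmetric p only W(a,b) + W(b,a) = 0 is forced, which leaves room for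
    other rates: with geometric mu, let a site holding one particle release
    it, a site holding two particles release one or two of them, and a fuller
    site release two at double rate ([two_jump_balance]). *)

Set Implicit Arguments.
Unset Strict Implicit.
Unset Printing Implicit Defensive.

Import Order.TTheory GRing.Theory Num.Theory.
Import numFieldNormedType.Exports.

Local Open Scope classical_set_scope.
Local Open Scope ring_scope.

(* The name is also that of an unrelated notion about measurable functions. *)
Local Notation finite_norm := Defs.finite_norm.

(** * Sums over countable families *)

Section countable_sums.
Context (R : realType) (I : countType).
Local Open Scope ereal_scope.
Implicit Types (A : set I) (a : I -> \bar R).

(** Transporting a family along the coding of a countable type by natural
    numbers makes the theorems about series and about the counting measure
    applicable to [esum]. *)
Definition coded A a (n : nat) : \bar R :=
  if pickle_inv n is Some i then if i \in A then a i else 0 else 0.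

Lemma coded_ge0 A a n : (forall i, 0 <= a i) -> 0 <= coded A a n.
Proof. by move=> a0; rewrite /coded; case: (pickle_inv n) => // i; case: ifP. Qed.

Lemma esum_coded A a : (forall i, 0 <= a i) ->
  \esum_(i in A) a i = \sum_(n <oo) coded A a n.
Proof.
move=> a0; rewrite nneseries_esumT; last by move=> n; exact: coded_ge0.
rewrite (esumID (range (@pickle I))); last by move=> n _; exact: coded_ge0.
rewrite setTI setTI [X in _ + X]esum1 ?adde0; last first.
  move=> n /= nr; rewrite /coded; have := @pickle_invK I n.
  by case: (pickle_inv n) => // i /= e; exfalso; apply: nr; exists i.
rewrite esum_image; last by move=> x y _ _; exact: pcan_inj pickleK_inv x y.
rewrite esum_mkcond; apply: eq_esum => i _.
by rewrite /coded pickleK_inv.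
Qed.

Context d (T : measurableType d).

Lemma measurable_esum A (D : set T) (a : I -> T -> \bar R) :
  (forall i x, 0 <= a i x) -> (forall i, measurable_fun D (a i)) ->
  measurable_fun D (fun x => \esum_(i in A) a i x).
Proof.
move=> a0 ma.
rewrite (_ : (fun _ => _) = fun x => \sum_(n <oo) coded A (a ^~ x) n); last first.
  by apply/funext => x; rewrite esum_coded.
apply: ge0_emeasurable_sum => [n x _ _|n _]; first exact: coded_ge0.
by rewrite /coded; case: (pickle_inv n) => // i; case: (i \in A).
Qed.

Lemma integral_esum (mu : {measure set T -> \bar R}) A (D : set T)
    (a : I -> T -> \bar R) : measurable D ->
  (forall i x, 0 <= a i x) -> (forall i, measurable_fun D (a i)) ->
  \int[mu]_(x in D) (\esum_(i in A) a i x) = \esum_(i in A) \int[mu]_(x in D) a i x.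
Proof.
move=> mD a0 ma; rewrite esum_coded; last by move=> i; exact: integral_ge0.
under eq_integral do rewrite esum_coded//.
rewrite integral_nneseries//=.
- apply: eq_eseriesr => n _; rewrite /coded; case: (pickle_inv n) => [i|].
    by case: ifP => // _; rewrite integral0.
  by rewrite integral0.
- by move=> n; rewrite /coded; case: (pickle_inv n) => // i; case: (i \in A).
- by move=> n x _; exact: coded_ge0.
Qed.

End countable_sums.

Section esum_complements.
Context (R : realType).
Local Open Scope ereal_scope.

(** Scaling by 1/c turns the inequality that suprema give directly into the
    opposite one. *)
Lemma ge0_esumZl (T : choiceType) (A : set T) (c : R) (a : T -> \bar R) :
  (0 <= c)%R -> (forall i, 0 <= a i) ->
  \esum_(i in A) (c%:E * a i) = c%:E * \esum_(i in A) a i.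
Proof.
have le_esumZl (r : R) (b : T -> \bar R) : (0 <= r)%R -> (forall i, 0 <= b i) ->
    \esum_(i in A) (r%:E * b i) <= r%:E * \esum_(i in A) b i.
  move=> r0 b0; apply: ge_ereal_sup => _ [F [finF FA] <-].
  rewrite -ge0_mule_fsumr//; apply: lee_wpmul2l; first by rewrite lee_fin.
  by apply: ereal_sup_ubound; exists F.
rewrite le_eqVlt => /predU1P[<- a0|c0 a0].
  by rewrite mul0e esum1// => i _; rewrite mul0e.
apply/eqP; rewrite eq_le; apply/andP; split; first by apply: le_esumZl => //; exact: ltW.
rewrite -lee_pdivlMl//.
have ca0 i : 0 <= c%:E * a i by rewrite mule_ge0// lee_fin ltW.
apply: le_trans (le_esumZl _ _ _ ca0); last by rewrite invr_ge0 ltW.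
by apply: le_esum => i _; rewrite muleA -EFinM mulVf ?gt_eqF// mul1e.
Qed.

Lemma ge0_esumZr (T : choiceType) (A : set T) (c : R) (a : T -> \bar R) :
  (0 <= c)%R -> (forall i, 0 <= a i) ->
  \esum_(i in A) (a i * c%:E) = (\esum_(i in A) a i) * c%:E.
Proof.
by move=> c0 a0; rewrite muleC -ge0_esumZl//; apply: eq_esum => i _; rewrite muleC.
Qed.

Lemma esum_fin_num (T : choiceType) (A : set T) (a : T -> \bar R) :
  (forall i, 0 <= a i) -> \esum_(i in A) a i < +oo ->
  \esum_(i in A) a i \is a fin_num.
Proof. by move=> a0 ?; rewrite ge0_fin_numE// esum_ge0. Qed.

Lemma rsumB (T : choiceType) (A : set T) (v w : T -> R) :
  (forall i, 0 <= v i)%R -> (forall i, 0 <= w i)%R ->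
  \esum_(i in A) (v i)%:E < +oo -> \esum_(i in A) (w i)%:E < +oo ->
  (rsum A (fun i => v i - w i)%R)%:E =
    \esum_(i in A) (v i)%:E - \esum_(i in A) (w i)%:E.
Proof.
move=> v0 w0 voo woo.
have sum_of (u : T -> R) : (forall i, 0 <= u i)%R ->
    \esum_(i in A) (u i)%:E < +oo -> summable A (EFin \o u).
  move=> u0 uoo; rewrite /summable (eq_esum (b := EFin \o u))// => i _ /=.
  by rewrite ger0_norm.
rewrite /rsum -[EFin \o _]/((EFin \o v) \- (EFin \o w)).
rewrite (esumB (sum_of _ v0 voo) (sum_of _ w0 woo)) /=.
- by rewrite fineK// fin_numB !esum_fin_num// => i; rewrite lee_fin.
- by move=> i _; rewrite lee_fin.
- by move=> i _; rewrite lee_fin.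
Qed.

Lemma esum_pair (T1 T2 : choiceType) (a : T1 * T2 -> \bar R) :
  (forall i, 0 <= a i) ->
  \esum_(i in setT) a i = \esum_(i in setT) \esum_(j in setT) a (i, j).
Proof.
move=> a0; rewrite (esum_esum (fun i j _ _ => a0 (i, j))).
by congr (esum _ _); [apply/seteqP; split|apply/funext => -[]].
Qed.

Lemma esum_exchange (T1 T2 : choiceType) (a : T1 -> T2 -> \bar R) :
  (forall i j, 0 <= a i j) ->
  \esum_(i in setT) \esum_(j in setT) a i j =
  \esum_(j in setT) \esum_(i in setT) a i j.
Proof.
move=> a0; rewrite -(esum_pair (a := fun i => a i.1 i.2))//.
rewrite (reindex_esum setT setT (fun i : T2 * T1 => (i.2, i.1))).
  by rewrite esum_pair.
by split=> // [[x y] [x' y'] _ _ [-> ->]//|[x y] _]; exists (y, x).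
Qed.

Lemma esum_single (T : choiceType) (a : T -> \bar R) (t : T) : 0 <= a t ->
  (forall u, u != t -> a u = 0) -> \esum_(u in setT) a u = a t.
Proof.
move=> at0 a0; rewrite -(esum_set1 at0) [RHS]esum_mkcond; apply: eq_esum => u _.
by case: ifPn => // /negP; rewrite inE /= => /eqP/a0.
Qed.

(** Used with a jump of k particles: the occupation before the jump is that
    after the jump plus k. *)
Lemma esum_shift (a : nat -> \bar R) k :
  \esum_(m in setT) a (m + k)%N = \esum_(b in setT) (if (k <= b)%N then a b else 0).
Proof.
transitivity (\esum_(b in [set b | (k <= b)%N]) a b).
  rewrite (_ : [set b | _] = [set (m + k)%N | m in setT]).
    by rewrite esum_image// => n m _ _ /addIn.
  apply/seteqP; split=> n /=; first by move=> kn; exists (n - k)%N => //; rewrite subnK.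
  by move=> [m _ <-]; rewrite leq_addl.
rewrite esum_mkcond; apply: eq_esum => b _.
by case: ifPn => [/set_mem /= ->//|/negP]; rewrite inE /= => /negP/negPf ->.
Qed.

Lemma esum_initial (a : nat -> \bar R) b : (forall k, 0 <= a k) ->
  \esum_(k in setT) (if (k <= b)%N then a k else 0) = \sum_(k < b.+1) a k.
Proof.
move=> a0.
transitivity (\esum_(k in `I_b.+1) a k).
  rewrite [RHS]esum_mkcond; apply: eq_esum => k _.
  by case: ifPn => [kb|/negP kb]; [rewrite mem_set|rewrite memNset].
by rewrite esum_fset ?fsbig_ord//; exact: finite_II.
Qed.

End esum_complements.

Lemma esum_term_le (R : realType) (T : choiceType) (c : T -> \bar R) t :
  (forall u, 0 <= c u)%E -> (c t <= \esum_(u in setT) c u)%E.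
Proof.
move=> c0; apply: esum_ge; exists [set t]; first by split=> //; exact: finite_set1.
by rewrite fsbig_set1.
Qed.

Lemma rsum_ge0E (R : realType) (T : choiceType) (A : set T) (v : T -> R) :
  (forall i, 0 <= v i) -> (\esum_(i in A) (v i)%:E < +oo)%E ->
  ((rsum A v)%:E = \esum_(i in A) (v i)%:E)%E.
Proof.
move=> v0 voo; have := rsumB (A := A) (w := fun=> 0) v0 (fun=> lexx 0) voo.
rewrite (esum1 (D := A) (a := fun=> 0%:E))// sube0 => /(_ (ltry _)) <-.
by congr ((rsum _ _)%:E); apply/funext => i; rewrite subr0.
Qed.


(** * Configurations and their measurable transformations *)

Section configurations.
Context (d : nat).
Implicit Types (x y z : lattice d) (eta zeta : conf d).

Definition upd x (n : nat) eta : conf d := fun z => if z == x then n else eta z.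

Definition gain x (k : nat) eta : conf d := upd x (eta x + k)%N eta.

Lemma upd_same x n eta : upd x n eta x = n.
Proof. by rewrite /upd eqxx. Qed.

Lemma upd_other x n eta z : z != x -> upd x n eta z = eta z.
Proof. by rewrite /upd => /negPf ->. Qed.

Lemma updC x y n m eta : x != y ->
  upd x n (upd y m eta) = upd y m (upd x n eta).
Proof.
move=> xy; apply/funext => z; rewrite /upd.
by case: eqVneq => // ->; rewrite (negPf xy).
Qed.

Lemma upd_upd x n m eta : upd x n (upd x m eta) = upd x n eta.
Proof. by apply/funext => z; rewrite /upd; case: eqVneq. Qed.

Lemma gain_upd x n k eta : gain x k (upd x n eta) = upd x (n + k)%N eta.
Proof. by rewrite /gain upd_same upd_upd. Qed.

Lemma gain_upd_other x y n k eta : x != y ->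
  gain y k (upd x n eta) = upd x n (gain y k eta).
Proof. by move=> xy; rewrite /gain upd_other 1?eq_sym// updC// eq_sym. Qed.

Lemma jumpE k x y eta : (k <= eta x)%N -> x != y ->
  jump k x y eta = upd x (eta x - k)%N (gain y k eta).
Proof.
move=> kx xy; rewrite /jump kx xy/=; apply/funext => z.
by rewrite /upd /gain /upd; case: eqVneq => // zx; case: eqVneq => // ->.
Qed.

(** Parametrising by the occupation n that x keeps after the jump makes the
    truncated subtraction of [jump] disappear. *)
Lemma jump_upd k n x y eta : x != y ->
  jump k x y (upd x (n + k)%N eta) = upd x n (gain y k eta).
Proof.
move=> xy; rewrite jumpE ?upd_same ?leq_addl// addnK.
by rewrite gain_upd_other// upd_upd.
Qed.

Lemma jump_same k x eta : jump k x x eta = eta.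
Proof. by rewrite /jump eqxx andbF. Qed.

Lemma measurable_site x n : measurable [set eta : conf d | eta x = n].
Proof. by apply: sub_sigma_algebra; exists x, n. Qed.

Lemma measurable_conf dT (T : measurableType dT) (F : T -> conf d) :
  (forall x n, measurable [set t | F t x = n]) -> measurable_fun setT F.
Proof.
move=> mF; apply: (@measurability _ _ T (conf d) setT F (@single_site_events d) erefl).
by move=> _ [_ [x [n ->]] <-]; rewrite setTI; exact: mF.
Qed.

Lemma measurable_pattern (s : seq (lattice d)) (v : seq nat) :
  measurable [set eta : conf d | map eta s = v].
Proof.
elim: s v => [|x s IH] [|n v].
- by rewrite (_ : [set _ | _] = setT)//; apply/seteqP; split.
- by rewrite (_ : [set _ | _] = set0)//; apply/seteqP; split.
- by rewrite (_ : [set _ | _] = set0)//; apply/seteqP; split.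
rewrite (_ : [set _ | _] = [set eta : conf d | eta x = n] `&`
                           [set eta : conf d | map eta s = v]).
  by apply: measurableI => //; exact: measurable_site.
by apply/seteqP; split=> eta /= [-> ->].
Qed.

(** Such a set is a union of patterns on s, and there are countably many
    patterns. *)
Lemma measurable_cylinder_set (s : seq (lattice d)) (A : set (conf d)) :
  (forall eta zeta, {in s, eta =1 zeta} -> A eta -> A zeta) -> measurable A.
Proof.
move=> cylA.
rewrite (_ : A = \bigcup_v (if v \in [set map (eta : conf d) s | eta in A]
                   then [set eta : conf d | map eta s = v] else set0)).
  apply: countable_bigcupT_measurable => [|v].
    exact: countableP.
  by case: ifP => // _; exact: measurable_pattern.
apply/seteqP; split=> [eta Aeta|eta [v _]].
  by exists (map eta s) => //; rewrite mem_set//; exists eta.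
case: ifPn => // /set_mem[zeta Azeta <-] /= e.
by apply: cylA Azeta => x xs; apply/esym; move/eq_in_map: e; apply.
Qed.

Lemma measurable_coord_set x (Y : set nat) : measurable [set eta : conf d | Y (eta x)].
Proof.
apply: (@measurable_cylinder_set [:: x]) => eta zeta h.
by rewrite /= h// inE.
Qed.

Lemma measurable_coord_fun dU (U : measurableType dU) (h : nat -> U) x :
  measurable_fun setT (fun eta : conf d => h (eta x)).
Proof. by move=> _ Y mY; rewrite setTI; exact: (measurable_coord_set x [set n | Y (h n)]). Qed.

Lemma measurable_cylinder (R : realType) (f : conf d -> R) :
  cylinder f -> measurable_fun setT f.
Proof.
move=> [s fs] _ Y mY; rewrite setTI; apply: (@measurable_cylinder_set s).
by move=> eta zeta h; rewrite /= (fs eta zeta).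
Qed.

Lemma measurable_upd x n : measurable_fun setT (upd x n).
Proof.
apply: measurable_conf => z m; apply: (@measurable_cylinder_set [:: z]).
by move=> eta zeta h; rewrite /= /upd; case: eqP => // _; rewrite h ?inE.
Qed.

Lemma measurable_gain x n : measurable_fun setT (gain x n).
Proof.
apply: measurable_conf => z m; apply: (@measurable_cylinder_set [:: x; z]).
by move=> eta zeta h; rewrite /= /gain /upd !h ?inE ?eqxx ?orbT.
Qed.

Lemma measurable_jump k x y : measurable_fun setT (jump k x y).
Proof.
apply: measurable_conf => z m; apply: (@measurable_cylinder_set [:: x; y; z]).
by move=> eta zeta h; rewrite /= /jump (h x) ?inE ?eqxx//; case: ifP => _;
  rewrite ?(h x) ?(h y) ?(h z) ?inE ?eqxx ?orbT.
Qed.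

End configurations.

(** * Resampling one site of a product measure *)

Section resampling.
Context (R : realType) (d : nat) (nu : probability (conf d) R) (mu : nat -> R).
Hypothesis nu_product : product_measure_on_sites nu.
Hypothesis nu_marginal : single_site_marginal nu mu.
Local Open Scope ereal_scope.
Implicit Types (x y : lattice d).

Lemma marginal_ge0 n : (0 <= mu n)%R.
Proof. by rewrite -lee_fin -(@nu_marginal 0%R n) measure_ge0. Qed.

Lemma marginal_sum1 : \esum_(n in setT) (mu n)%:E = 1.
Proof.
rewrite -nneseries_esumT; last by move=> n; rewrite lee_fin marginal_ge0.
under eq_eseriesr => n _ do rewrite -(@nu_marginal 0%R n).
rewrite -(@probability_setT _ _ _ nu).
rewrite (_ : [set: conf d] = \bigcup_n [set eta : conf d | eta 0%R = n]); last first.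
  by apply/seteqP; split=> // eta _; exists (eta 0%R).
rewrite measure_bigcup//.
- by apply: eq_eseriesl => n; rewrite in_setT.
- by move=> n _; exact: measurable_site.
- by move=> n m _ _ [eta [/= <- <-]].
Qed.

(** A pi-system on which the product structure is visible. *)
Definition site_patterns : set (set (conf d)) :=
  [set A | A = set0 \/ exists (s : seq (lattice d)) (n : lattice d -> nat),
     uniq s /\ A = [set eta | forall x, x \in s -> eta x = n x]].

Lemma site_patterns_setI : setI_closed site_patterns.
Proof.
move=> A B [->|[s [n [us ->]]]]; first by rewrite set0I; left.
move=> [->|[t [m [ut ->]]]]; first by rewrite setI0; left.
have [agree|disagree] := pselect (forall x, x \in s -> x \in t -> n x = m x).
  right; exists (undup (s ++ t)), (fun x => if x \in s then n x else m x).
  split; first exact: undup_uniq.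
  apply/seteqP; split=> eta /=.
    by move=> [en em] x; rewrite mem_undup mem_cat; case: ifP => [/en //|_ /= /em].
  move=> h; split=> x xs; rewrite h ?mem_undup ?mem_cat ?xs ?orbT//.
  by case: ifP => // xs'; exact: agree.
left; apply/seteqP; split=> // eta [/= en em]; apply: disagree => x xs xt.
by rewrite -en// em.
Qed.

Lemma site_patterns_generate : (@measurable _ (conf d)) = <<s site_patterns >>.
Proof.
apply/seteqP; split.
  apply: smallest_sub; first exact: smallest_sigma_algebra.
  move=> _ [x [n ->]]; apply: sub_sigma_algebra; right.
  exists [:: x], (fun=> n); split=> //.
  apply/seteqP; split=> eta /=; first by move=> e y; rewrite inE => /eqP ->.
  by move=> /(_ x); rewrite inE eqxx; apply.
apply: smallest_sub; first exact: sigma_algebra_measurable.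
move=> A [->//|[s [n [us ->]]]].
apply: (@measurable_cylinder_set _ s) => eta zeta h /= e x xs.
by rewrite -h// e.
Qed.

(** The part of the law of the resampled configuration in which the new
    occupation of x is n. *)
Definition resampled_mass x (n : nat) : {measure set (conf d) -> \bar R} :=
  mscale (NngNum (marginal_ge0 n))
    (measure_function_pushforward__canonical__measure_function_Measure nu (measurable_upd x n)).

Lemma resampled_mass_pattern x A : site_patterns A ->
  nu A = mseries (resampled_mass x) 0 A.
Proof.
move=> patA; have mA : measurable A.
  by rewrite site_patterns_generate; exact: sub_sigma_algebra.
case: patA mA => [->|[s [n [us ->]]] mA]; first by rewrite !measure0.
rewrite /mseries nneseries_esumT => [/=|k]; last exact: measure_ge0.
rewrite /mscale /pushforward /=.
have [xs|xNs] := boolP (x \in s); last first.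
  have fnu := fin_num_measure nu _ mA.
  rewrite -[LHS](fineK fnu) -[LHS]mul1e -marginal_sum1 -ge0_esumZr.
  - apply: eq_esum => k _; rewrite fineK//; congr (_ * nu _).
    apply/seteqP; split=> eta /= h y ys; have := h y ys.
      by rewrite upd_other//; apply: contraNneq xNs => <-.
    by rewrite upd_other//; apply: contraNneq xNs => <-.
  - by rewrite fine_ge0// measure_ge0.
  - by move=> k; rewrite lee_fin marginal_ge0.
rewrite (esum_single (t := n x)) /=.
- rewrite /pushforward [X in _ = _ * nu X](_ : _ =
      [set eta : conf d | forall y, y \in rem x s -> eta y = n y]).
    rewrite nu_product// nu_product ?rem_uniq//.
    by rewrite (big_rem x)//= -(@nu_marginal x (n x)).
  apply/seteqP; split=> eta /= h y.
    rewrite mem_rem_uniq// !inE => /andP[yx ys].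
    by have := h y ys; rewrite upd_other.
  move=> ys; have [->|yx] := eqVneq y x; first by rewrite upd_same.
  by rewrite upd_other// h// mem_rem_uniq// !inE yx.
- by apply: mule_ge0; [rewrite lee_fin marginal_ge0|rewrite /pushforward measure_ge0].
- move=> k kn; rewrite /pushforward [X in _ * nu X](_ : _ = set0) ?measure0 ?mule0//.
  apply/seteqP; split=> // eta /= /(_ x xs); rewrite upd_same => e.
  by move: kn; rewrite e eqxx.
Qed.

(** The occupation of x is independent of the rest, so replacing it by an
    independent copy does not change the law nu. *)
Lemma resample (F : conf d -> \bar R) x :
  measurable_fun setT F -> (forall eta, 0 <= F eta) ->
  \int[nu]_eta F eta =
    \esum_(n in setT) ((mu n)%:E * \int[nu]_eta F (upd x n eta)).
Proof.
move=> mF F0.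
transitivity (\int[mseries (resampled_mass x) 0]_eta F eta).
  apply: eq_measure_integral => A mA _.
  apply: (measure_unique site_patterns (fun=> setT)) => //.
  - exact: site_patterns_generate.
  - exact: site_patterns_setI.
  - move=> _; right; exists [::], (fun=> 0%N); split=> //.
    by apply/seteqP; split.
  - by rewrite bigcup_const.
  - by move=> B; exact: resampled_mass_pattern.
  - by move=> _; rewrite (le_lt_trans (probability_le1 nu _)) ?ltry.
rewrite ge0_integral_measure_series//.
rewrite nneseries_esumT => [|n]; last exact: integral_ge0.
apply: eq_esum => n _; rewrite ge0_integral_mscale//=; congr (_ * _).
by rewrite ge0_integral_pushforward//; exact: measurable_upd.
Qed.

End resampling.

(** * Integrating a signed sum *)

Section integral_of_rsum.
Context (R : realType) (I : countType) (dT : measure_display)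
  (T : measurableType dT) (m : {measure set T -> \bar R}).
Local Open Scope ereal_scope.

Lemma measurable_rsum (A : set I) (u : I -> T -> R) (D : set T) : measurable D ->
  (forall i, measurable_fun D (u i)) ->
  measurable_fun D (fun t => rsum A (u ^~ t)).
Proof.
move=> mD mu; rewrite /rsum; apply: (measurableT_comp (fine_measurable measurableT)).
apply: emeasurable_funB.
- apply: measurable_esum => [i t|i]; first exact: funepos_ge0.
  have mui : measurable_fun D (EFin \o u i) by exact/measurable_EFinP.
  rewrite (_ : (fun _ => _) = (EFin \o u i)^\+); first exact: measurable_funepos mui.
  by apply/funext => t; rewrite !funeposE.
- apply: measurable_esum => [i t|i]; first exact: funeneg_ge0.
  have mui : measurable_fun D (EFin \o u i) by exact/measurable_EFinP.
  rewrite (_ : (fun _ => _) = (EFin \o u i)^\-); first exact: measurable_funeneg mui.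
  by apply/funext => t; rewrite !funenegE.
Qed.

Lemma ge0_integrable_lty (f : T -> \bar R) : measurable_fun setT f ->
  (forall t, 0 <= f t) -> \int[m]_t f t < +oo -> m.-integrable setT f.
Proof.
move=> mf f0 fi; apply/integrableP; split=> //.
by under eq_integral do rewrite gee0_abs//.
Qed.

(** Almost everywhere both sums are finite, and there [rsum] is their
    difference; elsewhere its value is irrelevant. *)
Lemma integral_rsum (A : set I) (v w : I -> T -> R) :
  (forall i, measurable_fun setT (v i)) -> (forall i, measurable_fun setT (w i)) ->
  (forall i t, (0 <= v i t)%R) -> (forall i t, (0 <= w i t)%R) ->
  \esum_(i in A) (\int[m]_t (v i t)%:E) < +oo ->
  \esum_(i in A) (\int[m]_t (w i t)%:E) < +oo ->
  \int[m]_t (rsum A (fun i => v i t - w i t)%R)%:E =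
    \esum_(i in A) (\int[m]_t (v i t)%:E) - \esum_(i in A) (\int[m]_t (w i t)%:E).
Proof.
move=> mv mw v0 w0.
have mEv i : measurable_fun setT (EFin \o v i) by exact/measurable_EFinP.
have mEw i : measurable_fun setT (EFin \o w i) by exact/measurable_EFinP.
rewrite -(integral_esum m A measurableT (a := fun i t => (v i t)%:E))//.
rewrite -(integral_esum m A measurableT (a := fun i t => (w i t)%:E))//.
set P := fun t => \esum_(i in A) (v i t)%:E; set Q := fun t => \esum_(i in A) (w i t)%:E.
move=> Pi Qi.
have P0 t : 0 <= P t by apply: esum_ge0 => i _; rewrite lee_fin.
have Q0 t : 0 <= Q t by apply: esum_ge0 => i _; rewrite lee_fin.
have mP : measurable_fun setT P.
  by apply: measurable_esum => // i t; rewrite lee_fin.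
have mQ : measurable_fun setT Q.
  by apply: measurable_esum => // i t; rewrite lee_fin.
have iP := ge0_integrable_lty mP P0 Pi.
have iQ := ge0_integrable_lty mQ Q0 Qi.
rewrite -integralB//; apply: ae_eq_integral => //.
- apply/measurable_EFinP; apply: measurable_rsum => // i.
  exact: measurable_funB.
- exact: emeasurable_funB.
- have := integrable_ae measurableT iQ; apply: filterS2 (integrable_ae measurableT iP).
  move=> t Pt Qt _ /=; rewrite rsumB//.
    by rewrite ltey_eq Pt.
  by rewrite ltey_eq Qt.
Qed.

End integral_of_rsum.

(** * The integral of the generator applied to a cylinder function *)

Section site_integrals.
Context (R : realType) (d : nat) (nu : probability (conf d) R) (mu : nat -> R).
Hypothesis nu_product : product_measure_on_sites nu.
Hypothesis nu_marginal : single_site_marginal nu mu.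
Variable g : nat -> nat -> R.
Hypothesis g_ge0 : forall k n, (0 <= g k n)%R.
Hypothesis g_small : forall k n, (n < k)%N -> g k n = 0%R.
Local Open Scope ereal_scope.
Implicit Types (x y : lattice d) (f : conf d -> R).

(** The rate at which a site with law mu releases k particles and keeps n. *)
Definition flow (k n : nat) : R := (g k (n + k) * mu (n + k))%R.

Lemma flow_ge0 k n : (0 <= flow k n)%R.
Proof. by rewrite mulr_ge0// (marginal_ge0 nu_marginal). Qed.

Definition flow_integral (F : nat -> nat -> conf d -> R) : \bar R :=
  \esum_(i in [set: nat * nat])
    ((flow i.1 i.2)%:E * \int[nu]_eta (F i.1 i.2 eta)%:E).

Definition site_integral x (F : nat -> conf d -> R) : \bar R :=
  \esum_(k in setT) \int[nu]_eta (g k (eta x) * F k eta)%:E.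

(** Resampling x makes the rate deterministic; the sum is then reindexed by
    the number of particles left at x. *)
Lemma site_integralE x (F : nat -> conf d -> R) :
  (forall k, measurable_fun setT (F k)) -> (forall k eta, 0 <= F k eta)%R ->
  site_integral x F = flow_integral (fun k n eta => F k (upd x (n + k)%N eta)).
Proof.
move=> mF F0; have EF0 k eta : 0 <= (F k eta)%:E by rewrite lee_fin.
have If0 k n : 0 <= \int[nu]_eta (F k (upd x n eta))%:E.
  by apply: integral_ge0 => eta _.
rewrite /site_integral /flow_integral esum_pair; last first.
  by move=> -[k n] /=; rewrite mule_ge0// lee_fin flow_ge0.
apply: eq_esum => k _ /=.
rewrite (resample nu_product nu_marginal x) //=; last 2 first.
- by apply/measurable_EFinP; apply: measurable_funM => //; exact: measurable_coord_fun.
- by move=> eta; rewrite lee_fin mulr_ge0.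
under eq_esum => n _.
  under eq_integral do rewrite upd_same EFinM.
  rewrite ge0_integralZl//; last 2 first.
  - apply/measurable_EFinP; apply: measurableT_comp; first exact: mF.
    exact: measurable_upd.
  - by rewrite lee_fin.
  rewrite muleA -EFinM mulrC.
  over.
rewrite (esum_shift (fun n => (g k n * mu n)%:E * \int[nu]_eta (F k (upd x n eta))%:E)).
by apply: eq_esum => n _; case: ifPn => //; rewrite -ltnNge => nk; rewrite g_small// mul0r mul0e.
Qed.

End site_integrals.

Section generator_integral.
Context (R : realType) (d : nat) (nu : probability (conf d) R) (mu : nat -> R).
Hypothesis nu_product : product_measure_on_sites nu.
Hypothesis nu_marginal : single_site_marginal nu mu.
Variable g : nat -> nat -> R.
Hypothesis g_ge0 : forall k n, (0 <= g k n)%R.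
Hypothesis g_0 : forall n, g 0%N n = 0%R.
Hypothesis g_small : forall k n, (n < k)%N -> g k n = 0%R.
Variable p : lattice d -> lattice d -> R.
Hypothesis p_ge0 : forall x y, (0 <= p x y)%R.
Local Open Scope ereal_scope.
Hypothesis p_row : forall x, \esum_(y in setT) (p x y)%:E = 1.
Hypothesis p_col : forall y, \esum_(x in setT) (p x y)%:E = 1.
Local Notation flow := (flow mu g).
Local Notation flow_integral := (flow_integral nu mu g).
Hypothesis flow_finite : \esum_(i in [set: nat * nat]) (flow i.1 i.2)%:E < +oo.
Implicit Types (x y : lattice d).

Lemma flow_integral_le (B : R) (F : nat -> nat -> conf d -> R) : (0 <= B)%R ->
  (forall k n, measurable_fun setT (F k n)) ->
  (forall k n eta, 0 <= F k n eta <= B)%R ->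
  flow_integral F <= (\esum_(i in [set: nat * nat]) (flow i.1 i.2)%:E) * B%:E.
Proof.
move=> B0 mF FB; have fl0 k n := flow_ge0 nu_marginal g_ge0 k n.
rewrite -ge0_esumZr//; last by move=> i; rewrite lee_fin.
apply: le_esum => i _; apply: lee_wpmul2l; first by rewrite lee_fin.
apply: (@le_trans _ _ (\int[nu]_(_ in setT) B%:E)).
  apply: ge0_le_integral => //=.
  - by move=> eta _; rewrite lee_fin; case/andP: (FB i.1 i.2 eta).
  - exact/measurable_EFinP.
  - by move=> eta _; rewrite lee_fin; case/andP: (FB i.1 i.2 eta).
by rewrite integral_cst//= probability_setT mule1.
Qed.

Lemma flow_integral_ge0 (F : nat -> nat -> conf d -> R) :
  (forall k n eta, 0 <= F k n eta)%R -> 0 <= flow_integral F.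
Proof.
move=> F0; apply: esum_ge0 => i _; rewrite mule_ge0//.
  by rewrite lee_fin (flow_ge0 nu_marginal).
by apply: integral_ge0 => eta _; rewrite lee_fin.
Qed.

Lemma flow_integral_fin_num (B : R) (F : nat -> nat -> conf d -> R) :
  (forall k n, measurable_fun setT (F k n)) ->
  (forall k n eta, 0 <= F k n eta <= B)%R ->
  flow_integral F \is a fin_num.
Proof.
move=> mF FB; have F0 k n eta : (0 <= F k n eta)%R by case/andP: (FB k n eta).
have B0 : (0 <= B)%R.
  by have /andP[] := FB 0%N 0%N (fun=> 0%N); exact: le_trans.
rewrite ge0_fin_numE ?flow_integral_ge0//.
apply: le_lt_trans (flow_integral_le B0 mF FB) _.
have fl0 i : 0 <= (flow i.1 i.2)%:E by rewrite lee_fin (flow_ge0 nu_marginal).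
by apply: lte_mul_pinfty; rewrite ?ltry ?esum_ge0 ?esum_fin_num.
Qed.

(** Only jumps from or to s change a function that depends on s alone. *)
Definition touching (s : seq (lattice d)) : set (lattice d * lattice d) :=
  [set i | (i.1 \in s) || (i.2 \in s)].

Lemma esum_seq (a : lattice d -> \bar R) (s : seq (lattice d)) : uniq s ->
  (forall x, 0 <= a x) ->
  \esum_(x in [set x | x \in s]) a x = \sum_(x <- s) a x.
Proof.
by move=> us a0; rewrite esum_fset//; [rewrite -fsbig_seq|exact: finite_seq].
Qed.

Lemma outside_sum (q : lattice d -> R) (s : seq (lattice d)) : uniq s ->
  (forall x, 0 <= q x)%R -> \esum_(x in setT) (q x)%:E = 1 ->
  \esum_(x in ~` [set x | x \in s]) (q x)%:E = (1 - \sum_(x <- s) q x)%:E.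
Proof.
move=> us q0; have Eq0 x : 0 <= (q x)%:E by rewrite lee_fin.
rewrite (esumID [set x | x \in s]) ?setTI// esum_seq// sumEFin => e.
by rewrite EFinB -[1%:E]e addeAC subee ?add0e.
Qed.

(** Double stochasticity evaluates the sums of p over the complement of s. *)
Lemma touching_sum (s : seq (lattice d)) (K : lattice d -> lattice d -> R)
    (D A : lattice d -> R) : uniq s ->
  (forall x y, 0 <= K x y)%R -> (forall x, 0 <= D x)%R -> (forall y, 0 <= A y)%R ->
  (forall x y, x \in s -> y \notin s -> K x y = D x) ->
  (forall x y, x \notin s -> y \in s -> K x y = A y) ->
  \esum_(i in touching s) ((p i.1 i.2)%:E * (K i.1 i.2)%:E) =
  (\sum_(x <- s) \sum_(y <- s) p x y * K x y +
   \sum_(x <- s) (1 - \sum_(y <- s) p x y) * D x +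
   \sum_(y <- s) (1 - \sum_(x <- s) p x y) * A y)%:E.
Proof.
move=> us K0 D0 A0 KD KA; pose S := [set x : lattice d | x \in s].
have pK0 x y : 0 <= (p x y)%:E * (K x y)%:E by rewrite mule_ge0// lee_fin.
have esumS (a : lattice d -> \bar R) : (forall x, 0 <= a x) ->
  \esum_(x in S) a x = \sum_(x <- s) a x by move=> a0; exact: esum_seq.
rewrite (esumID (S `*` setT)); last by move=> -[x y].
rewrite (_ : touching s `&` S `*` setT = S `*`` (fun=> setT)); last first.
  by apply/seteqP; split=> [[x y] [_ [xs]]//|[x y] [/= xs _]]; split=> //=; rewrite /touching /= xs.
rewrite -(esum_esum (a := fun x y => (p x y)%:E * (K x y)%:E))//.
rewrite (_ : touching s `&` ~` (S `*` setT) = (fun i => (i.2, i.1)) @` (S `*`` (fun=> ~` S))); last first.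
  apply/seteqP; split=> [[x y] [/= xy /not_andP[xs|//]]|_ [[y x] [/= ys xs] <-]].
    by exists (y, x) => //; split=> //=; move: xy; rewrite /touching/= => /orP[].
  by split=> /=; [rewrite /touching/= ys orbT|case].
rewrite esum_image; last by move=> [y x] [y' x'] _ _ [-> ->].
rewrite -(esum_esum (a := fun y x => (p x y)%:E * (K x y)%:E))//.
rewrite !esumS; try by move=> x; apply: esum_ge0.
rewrite !EFinD; congr (_ + _).
  rewrite -EFinD -big_split/= -sumEFin; apply: eq_big_seq => x xs.
  rewrite (esumID S)// setTI esumS// EFinD; congr (_ + _).
    by rewrite -sumEFin; apply: eq_bigr => y _; rewrite EFinM.
  rewrite setTI EFinM -outside_sum// -ge0_esumZr//; last by move=> y; rewrite lee_fin.
  by apply: eq_esum => y /negP ys; rewrite KD.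
rewrite -sumEFin; apply: eq_big_seq => y ys.
rewrite EFinM -outside_sum// -ge0_esumZr//; last by move=> x; rewrite lee_fin.
by apply: eq_esum => x /negP xs; rewrite KA.
Qed.

End generator_integral.

Section generator_balance.
Context (R : realType) (d : nat) (nu : probability (conf d) R) (mu : nat -> R).
Hypothesis nu_product : product_measure_on_sites nu.
Hypothesis nu_marginal : single_site_marginal nu mu.
Variable g : nat -> nat -> R.
Hypothesis g_ge0 : forall k n, 0 <= g k n.
Hypothesis g_0 : forall n, g 0%N n = 0.
Hypothesis g_small : forall k n, (n < k)%N -> g k n = 0.
Variable p : lattice d -> lattice d -> R.
Hypothesis p_ge0 : forall x y, 0 <= p x y.
Hypothesis p_row : forall x, \esum_(y in setT) (p x y)%:E = 1%E.
Hypothesis p_col : forall y, \esum_(x in setT) (p x y)%:E = 1%E.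
Local Notation flow := (flow mu g).
Local Notation flow_integral := (flow_integral nu mu g).
Hypothesis flow_finite :
  (\esum_(i in [set: nat * nat]) (flow i.1 i.2)%:E < +oo)%E.
Implicit Types (x y : lattice d).

Variables (f : conf d -> R) (B : R).
Hypothesis f_cylinder : cylinder f.
Hypothesis f_bounded : forall eta, 0 <= f eta <= B.

(** The values of the sum over k of int g^k(eta x) f(S^k_(x,y) eta): the jump
    is not performed ([exit_rate]), leads from a site on which f depends to one
    on which it does not ([departure]) or conversely ([arrival]), concerns
    f in no way ([idle]), or is a jump between two arbitrary sites
    ([exchange]). *)
Definition exit_rate x : \bar R := flow_integral (fun k n eta => f (upd x (n + k)%N eta)).
Definition departure x : \bar R := flow_integral (fun k n eta => f (upd x n eta)).
Definition arrival x : \bar R := flow_integral (fun k n eta => f (gain x k eta)).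
Definition idle : \bar R := flow_integral (fun k n eta => f eta).
Definition exchange x y : \bar R :=
  if x == y then exit_rate x
  else flow_integral (fun k n eta => f (upd x n (gain y k eta))).

Let mf : measurable_fun setT f := measurable_cylinder f_cylinder.

Let mfT (T : conf d -> conf d) : measurable_fun setT T ->
  measurable_fun setT (f \o T).
Proof. exact: measurableT_comp. Qed.

Let f_ge0 eta : 0 <= f eta. Proof. by case/andP: (f_bounded eta). Qed.

Let fin_flow (T : nat -> nat -> conf d -> conf d) :
  (forall k n, measurable_fun setT (T k n)) ->
  flow_integral (fun k n => f \o T k n) \is a fin_num.
Proof.
move=> mT; apply: (flow_integral_fin_num nu_marginal g_ge0 flow_finite (B := B)).
  by move=> k n; exact: mfT.
by move=> k n eta; exact: f_bounded.
Qed.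

Lemma exit_rate_fin_num x : exit_rate x \is a fin_num.
Proof. by apply: (fin_flow (T := fun k n => upd x (n + k)%N)) => k n; exact: measurable_upd. Qed.

Lemma departure_fin_num x : departure x \is a fin_num.
Proof. by apply: (fin_flow (T := fun k n => upd x n)) => k n; exact: measurable_upd. Qed.

Lemma arrival_fin_num x : arrival x \is a fin_num.
Proof. by apply: (fin_flow (T := fun k n => gain x k)) => k n; exact: measurable_gain. Qed.

Lemma idle_fin_num : idle \is a fin_num.
Proof. by apply: (fin_flow (T := fun k n eta => eta)) => k n; exact: measurable_id. Qed.

Lemma exchange_fin_num x y : exchange x y \is a fin_num.
Proof.
rewrite /exchange; case: eqVneq => _; first exact: exit_rate_fin_num.
apply: (fin_flow (T := fun k n eta => upd x n (gain y k eta))) => k n.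
by apply: measurableT_comp; [exact: measurable_upd|exact: measurable_gain].
Qed.

Lemma site_integral_jump x y :
  site_integral nu g x (fun k eta => f (jump k x y eta)) = exchange x y.
Proof.
rewrite (site_integralE nu_product nu_marginal)//; last first.
  by move=> k; apply: mfT; exact: measurable_jump.
rewrite /exchange; case: eqVneq => [->|xy]; apply: eq_esum => -[k n] _ /=.
  by under eq_integral do rewrite jump_same.
by under eq_integral do rewrite jump_upd//.
Qed.

Lemma site_integral_stay x :
  site_integral nu g x (fun _ => f) = exit_rate x.
Proof. by rewrite (site_integralE nu_product nu_marginal). Qed.

Lemma esum_jumps (s : seq (lattice d)) (h : lattice d -> lattice d -> nat -> conf d -> R) :
  (forall x y k, measurable_fun setT (h x y k)) ->
  (forall x y k eta, 0 <= h x y k eta) ->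
  (\esum_(i in [set i : lattice d * lattice d * nat | (0 < i.2)%N])
    \int[nu]_eta (let: (x, y, k) := i in
      if (x \in s) || (y \in s) then p x y * (g k (eta x) * h x y k eta) else 0)%:E
  = \esum_(i in touching s)
      ((p i.1 i.2)%:E * site_integral nu g i.1 (h i.1 i.2)))%E.
Proof.
move=> mh h0; rewrite esum_mkcond [RHS]esum_mkcond esum_pair; last first.
  move=> [[x y] k]; case: ifP => // _; apply: integral_ge0 => eta _.
  by rewrite lee_fin; case: ifP => // _; rewrite mulr_ge0// mulr_ge0.
apply: eq_esum => -[x y] _ /=.
have [xys|xys] := boolP ((x \in s) || (y \in s)).
  rewrite mem_set// /site_integral -ge0_esumZl//; last first.
    by move=> k; apply: integral_ge0 => eta _; rewrite lee_fin mulr_ge0.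
  apply: eq_esum => -[_|k _].
    rewrite memNset//=; under eq_integral do rewrite g_0 mul0r.
    by rewrite integral0 mule0.
  rewrite mem_set//= -ge0_integralZl//; last 3 first.
  - apply/measurable_EFinP; apply: measurable_funM => //; exact: measurable_coord_fun.
  - by move=> eta _; rewrite lee_fin mulr_ge0.
  - by rewrite lee_fin.
rewrite memNset; last exact/negP.
apply: esum1 => k _; case: ifP => // _.
exact: integral0.
Qed.

Lemma upd_cylinder (s : seq (lattice d)) x n eta :
  (forall eta zeta : conf d, (forall x, x \in s -> eta x = zeta x) -> f eta = f zeta) ->
  x \notin s -> f (upd x n eta) = f eta.
Proof.
by move=> fs xs; apply: fs => z zs; rewrite upd_other//; apply: contraNneq xs => <-.
Qed.

(** The gains and the losses are summed over the jumps touching s only, so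
    that both sums are finite and can be subtracted. *)
Lemma integral_generator (s : seq (lattice d)) : uniq s ->
  (forall eta zeta : conf d, (forall x, x \in s -> eta x = zeta x) -> f eta = f zeta) ->
  (\int[nu]_eta (generator p (zrp_rates g) f eta)%:E)%E =
  (\sum_(x <- s) \sum_(y <- s) p x y * (fine (exchange x y) - fine (exit_rate x)) +
   \sum_(x <- s) (1 - \sum_(y <- s) p x y) * (fine (departure x) - fine (exit_rate x)) +
   \sum_(y <- s) (1 - \sum_(x <- s) p x y) * (fine (arrival y) - fine idle))%:E.
Proof.
move=> us fs; have upds := upd_cylinder _ _ fs.
pose h1 x y k eta := f (jump k x y eta); pose h2 (x y : lattice d) (k : nat) := f.
pose cut (h : lattice d -> lattice d -> nat -> conf d -> R)
    (i : lattice d * lattice d * nat) (eta : conf d) :=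
  let: (x, y, k) := i in
  if (x \in s) || (y \in s) then p x y * (g k (eta x) * h x y k eta) else 0.
have genE eta : generator p (zrp_rates g) f eta =
    rsum [set i : lattice d * lattice d * nat | (0 < i.2)%N]
      (fun i => cut h1 i eta - cut h2 i eta).
  rewrite /generator; congr (rsum _ _); apply/funext => -[[x y] k] /=.
  case: ifPn => [_|]; first by rewrite /h1 /h2 /zrp_rates; ring.
  rewrite negb_or => /andP[xs ys]; rewrite subrr (fs _ eta) ?subrr ?mulr0// => z zs.
  rewrite /jump; case: ifP => // _.
  by rewrite !ifN//; [apply: contraNneq ys|apply: contraNneq xs] => <-.
have mh1 x y k : measurable_fun setT (h1 x y k) by apply: mfT; exact: measurable_jump.
have mh2 x y k : measurable_fun setT (h2 x y k) by [].
have mcut h i : (forall x y k, measurable_fun setT (h x y k)) ->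
    measurable_fun setT (cut h i).
  move=> mh; case: i => -[x y] k; rewrite /cut; case: (_ || _) => //.
  do 2![apply: measurable_funM => //]; exact: measurable_coord_fun.
have cut_ge0 h i eta : (forall x y k eta, 0 <= h x y k eta) -> 0 <= cut h i eta.
  by move=> h0; case: i => -[x y] k; rewrite /cut; case: ifP => // _; rewrite !mulr_ge0.
have ge0_flow (F : nat -> nat -> conf d -> conf d) :
    0 <= fine (flow_integral (fun k n eta => f (F k n eta))).
  by rewrite fine_ge0// (flow_integral_ge0 nu_marginal).
have sum1 : (\esum_(i in [set i : lattice d * lattice d * nat | (0 < i.2)%N])
    \int[nu]_eta (cut h1 i eta)%:E =
  (\sum_(x <- s) \sum_(y <- s) p x y * fine (exchange x y) +
   \sum_(x <- s) (1 - \sum_(y <- s) p x y) * fine (departure x) +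
   \sum_(y <- s) (1 - \sum_(x <- s) p x y) * fine (arrival y))%:E)%E.
  rewrite (esum_jumps s mh1)//; last by move=> *; exact: f_ge0.
  rewrite -(touching_sum p_ge0 p_row p_col)//; last 5 first.
  - by move=> x y; rewrite /exchange; case: ifP => _; exact: ge0_flow.
  - by move=> x; exact: ge0_flow.
  - by move=> x; exact: ge0_flow.
  - move=> x y xs ys; rewrite /exchange ifN; last by apply: contraNneq ys => <-.
    congr fine; apply: eq_esum => -[k n] _ /=; congr (_ * _)%E.
    apply: eq_integral => eta _; rewrite -gain_upd_other; last by apply: contraNneq ys => <-.
    by rewrite /gain upds.
  - move=> x y xs ys; rewrite /exchange ifN; last by apply: contraNneq xs => ->.
    congr fine; apply: eq_esum => -[k n] _ /=; congr (_ * _)%E.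
    by apply: eq_integral => eta _; rewrite upds.
  by apply: eq_esum => -[x y] _ /=; rewrite site_integral_jump fineK// exchange_fin_num.
have sum2 : (\esum_(i in [set i : lattice d * lattice d * nat | (0 < i.2)%N])
    \int[nu]_eta (cut h2 i eta)%:E =
  (\sum_(x <- s) \sum_(y <- s) p x y * fine (exit_rate x) +
   \sum_(x <- s) (1 - \sum_(y <- s) p x y) * fine (exit_rate x) +
   \sum_(y <- s) (1 - \sum_(x <- s) p x y) * fine idle)%:E)%E.
  rewrite (esum_jumps s mh2)//.
  rewrite -(touching_sum p_ge0 p_row p_col (K := fun x y => fine (exit_rate x))
     (D := fun x => fine (exit_rate x)))//; last 4 first.
  - by move=> x y; exact: ge0_flow.
  - by move=> x; exact: ge0_flow.
  - by move=> x; exact: ge0_flow.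
  - move=> x y xs ys.
    congr fine; apply: eq_esum => -[k n] _ /=; congr (_ * _)%E.
    by apply: eq_integral => eta _; rewrite upds.
  by apply: eq_esum => -[x y] _ /=; rewrite site_integral_stay fineK// exit_rate_fin_num.
under eq_integral do rewrite genE.
rewrite integral_rsum; last 6 first.
- by move=> i; exact: mcut.
- by move=> i; exact: mcut.
- by move=> i eta; apply: cut_ge0 => *; exact: f_ge0.
- by move=> i eta; apply: cut_ge0 => *; exact: f_ge0.
- by rewrite sum1 ltry.
- by rewrite sum2 ltry.
rewrite sum1 sum2 -EFinB; congr (_%:E).
under [in RHS]eq_bigr => x _ do under eq_bigr => y _ do rewrite mulrBr.
under [in RHS]eq_bigr => x _ do rewrite sumrB.
under [X in _ = _ + X + _]eq_bigr => x _ do rewrite mulrBr.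
under [X in _ = _ + X]eq_bigr => x _ do rewrite mulrBr.
rewrite !sumrB.
have regroup (a b c a' b' c' : R) :
  a + b + c - (a' + b' + c') = (a - a') + (b - b') + (c - c') by ring.
exact: regroup.
Qed.

(** Replacing the functionals by real variables keeps the algebra that
    follows independent of their definitions. *)
Lemma integral_generator_values : exists E X D A Z,
  [/\ forall x y, exchange x y = (E x y)%:E,
      (forall x, exit_rate x = (X x)%:E) /\ (forall x, departure x = (D x)%:E),
      (forall x, arrival x = (A x)%:E) /\ idle = Z%:E
    & forall s : seq (lattice d), uniq s ->
      (forall eta zeta : conf d, (forall x, x \in s -> eta x = zeta x) -> f eta = f zeta) ->
      (\int[nu]_eta (generator p (zrp_rates g) f eta)%:E)%E =
      (\sum_(x <- s) \sum_(y <- s) p x y * (E x y - X x) +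
       \sum_(x <- s) (1 - \sum_(y <- s) p x y) * (D x - X x) +
       \sum_(y <- s) (1 - \sum_(x <- s) p x y) * (A y - Z))%:E].
Proof.
exists (fun x y => fine (exchange x y)), (fun x => fine (exit_rate x)).
exists (fun x => fine (departure x)), (fun x => fine (arrival x)), (fine idle).
split=> [x y||| s us fs].
- exact/esym/fineK/exchange_fin_num.
- by split=> x; apply/esym/fineK; [exact: exit_rate_fin_num|exact: departure_fin_num].
- by split=> [x|]; apply/esym/fineK; [exact: arrival_fin_num|exact: idle_fin_num].
- exact: (integral_generator us fs).
Qed.

End generator_balance.

(** * Sufficiency of the product condition *)

Section sufficiency.
Context (R : realType) (d : nat) (nu : probability (conf d) R) (mu : nat -> R).
Hypothesis nu_product : product_measure_on_sites nu.
Hypothesis nu_marginal : single_site_marginal nu mu.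
Variable g : nat -> nat -> R.
Hypothesis g_ge0 : forall k n, 0 <= g k n.
Hypothesis g_0 : forall n, g 0%N n = 0.
Hypothesis g_small : forall k n, (n < k)%N -> g k n = 0.
Variable p : lattice d -> lattice d -> R.
Hypothesis p_ge0 : forall x y, 0 <= p x y.
Hypothesis p_row : forall x, \esum_(y in setT) (p x y)%:E = 1%E.
Hypothesis p_col : forall y, \esum_(x in setT) (p x y)%:E = 1%E.
Local Notation flow := (flow mu g).
Local Notation flow_integral := (flow_integral nu mu g).
Hypothesis flow_finite :
  (\esum_(i in [set: nat * nat]) (flow i.1 i.2)%:E < +oo)%E.
Implicit Types (x y : lattice d).

(** The generator ignores constants, so a bounded function may be assumed
    nonnegative. *)
Lemma integral_generator_eq0 (f : conf d -> R) :
  (forall (h : conf d -> R) B, cylinder h -> (forall eta, 0 <= h eta <= B) ->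
     (\int[nu]_eta (generator p (zrp_rates g) h eta)%:E = 0)%E) ->
  bounded_on setT f -> cylinder f ->
  (\int[nu]_eta (generator p (zrp_rates g) f eta)%:E = 0)%E.
Proof.
move=> pos [B fB] [s fs].
rewrite -(pos (fun eta => f eta + B) (B + B)).
- apply: eq_integral => eta _; congr ((rsum _ _)%:E).
  by apply/funext => -[[x y] k]; ring.
- by exists s => eta zeta h; rewrite (fs _ _ h).
- move=> eta; have := fB eta I; rewrite ler_norml => /andP[].
  by rewrite -lerBlDr sub0r => -> /=; rewrite lerD2r.
Qed.

Lemma product_condition_flow : 0 < mu 0%N -> product_condition g mu ->
  forall k n, flow k n = mu n * (mu k / mu 0%N * g k k).
Proof.
move=> mu0 pc [|k] [|n]; rewrite /flow ?g_0 ?mul0r ?mulr0//.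
  by rewrite add0n; field; rewrite gt_eqF.
by rewrite pc// -mulrA.
Qed.

Section product_flow.
Variable c : nat -> R.
Hypothesis c_ge0 : forall k, 0 <= c k.
Hypothesis flow_product : forall k n, flow k n = mu n * c k.
Local Open Scope ereal_scope.

Let mu_ge0 := marginal_ge0 nu_marginal.

(** When the flow factorises, the occupation left at x has law mu up to the
    factor c k: by [resample] it is the one x would have anyway. *)
Lemma flow_resample x (G : nat -> conf d -> R) :
  (forall k, measurable_fun setT (G k)) -> (forall k eta, 0 <= G k eta)%R ->
  (forall k, \int[nu]_eta (G k eta)%:E < +oo) ->
  flow_integral (fun k n eta => G k (upd x n eta)) = flow_integral (fun k _ => G k).
Proof.
move=> mG G0 Goo.
have IG0 k (T : conf d -> conf d) : 0 <= \int[nu]_eta (G k (T eta))%:E.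
  by apply: integral_ge0 => eta _; rewrite lee_fin.
have fl0 k n : 0 <= (flow k n)%:E by rewrite lee_fin (flow_ge0 nu_marginal).
rewrite /flow_integral !esum_pair; try by move=> -[k n]; rewrite mule_ge0//; apply: (IG0 _ id).
apply: eq_esum => k _ /=.
have cmu n : (flow k n)%:E = (c k)%:E * (mu n)%:E by rewrite flow_product mulrC EFinM.
under eq_esum do rewrite cmu -muleA.
under [RHS]eq_esum do rewrite cmu -muleA.
rewrite !ge0_esumZl//; try by move=> n; rewrite mule_ge0 ?lee_fin//; apply: (IG0 _ id).
congr (_ * _).
rewrite -(resample nu_product nu_marginal x (F := fun eta => (G k eta)%:E)); last 2 first.
- exact/measurable_EFinP.
- by move=> eta; rewrite lee_fin.
have finI : \int[nu]_eta (G k eta)%:E \is a fin_num.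
  by rewrite ge0_fin_numE//; apply: (IG0 _ id).
rewrite -(fineK finI) ge0_esumZr; first by rewrite (marginal_sum1 nu_marginal) mul1e.
  by rewrite fine_ge0//; apply: (IG0 _ id).
by move=> n; rewrite lee_fin.
Qed.

End product_flow.

Local Open Scope ereal_scope.

Lemma bounded_integral_lty (G : conf d -> R) B : measurable_fun setT G ->
  (forall eta, 0 <= G eta <= B)%R -> \int[nu]_eta (G eta)%:E < +oo.
Proof.
move=> mG GB; apply: (@le_lt_trans _ _ (\int[nu]_(_ in setT) B%:E)).
  apply: ge0_le_integral => //=.
  - by move=> eta _; rewrite lee_fin; case/andP: (GB eta).
  - exact/measurable_EFinP.
  - by move=> eta _; rewrite lee_fin; case/andP: (GB eta).
by rewrite integral_cst//= probability_setT mule1 ltry.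
Qed.

(** By [flow_resample], an exchange between x and y is worth an arrival at y,
    a departure is worth nothing happening, and [exit_rate] equals
    [arrival]. *)
Lemma product_condition_generator (f : conf d -> R) :
  (0 < mu 0%N)%R -> product_condition g mu -> bounded_on setT f -> cylinder f ->
  \int[nu]_eta (generator p (zrp_rates g) f eta)%:E = 0.
Proof.
move=> mu0 pc; apply: integral_generator_eq0 => {}f B cf fB.
have mu_ge0 := marginal_ge0 nu_marginal.
have c0 k : (0 <= mu k / mu 0%N * g k k)%R by rewrite mulr_ge0// divr_ge0.
have resampling := flow_resample c0 (product_condition_flow mu0 pc).
have mf := measurable_cylinder cf.
have f0 eta : (0 <= f eta)%R by case/andP: (fB eta).
have resampleT x (T : nat -> conf d -> conf d) : (forall k, measurable_fun setT (T k)) ->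
    flow_integral (fun k n eta => f (T k (upd x n eta))) =
    flow_integral (fun k _ eta => f (T k eta)).
  move=> mT; have mfT k : measurable_fun setT (f \o T k) by exact: measurableT_comp.
  apply: (resampling x (fun k => f \o T k)) => // k; first by move=> eta; exact: f0.
  exact: (@bounded_integral_lty (f \o T k) B (mfT k) (fun eta => fB (T k eta))).
have exit_arrival x : exit_rate nu mu g f x = arrival nu mu g f x.
  rewrite /arrival -(resampleT x (fun k => gain x k)); last by move=> k; exact: measurable_gain.
  by apply: eq_esum => -[k n] _ /=; under [in RHS]eq_integral do rewrite gain_upd.
have departure_idle x : departure nu mu g f x = idle nu mu g f.
  by rewrite /idle -(resampleT x (fun k => id)).
have exchange_arrival x y : exchange nu mu g f x y = arrival nu mu g f y.
  rewrite /exchange; case: eqVneq => [->//|xy].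
  rewrite /arrival -(resampleT x (fun k => gain y k)); last by move=> k; exact: measurable_gain.
  by apply: eq_esum => -[k n] _ /=; under [in RHS]eq_integral do rewrite gain_upd_other//.
have [s fs] := cf.
rewrite (integral_generator nu_product nu_marginal g_ge0 g_0 g_small p_ge0 p_row p_col flow_finite cf fB
  (undup_uniq s)); last by move=> eta zeta h; apply: fs => x xs; apply: h; rewrite mem_undup.
congr (_%:E); set t := undup s; set i := fine (idle _ _ _ _).
pose a x := fine (arrival nu mu g f x).
under eq_bigr => x _ do under eq_bigr => y _ do rewrite exchange_arrival exit_arrival -/(a x) -/(a y) mulrBr.
under eq_bigr => x _ do rewrite sumrB -mulr_suml.
under [X in (_ + X + _)%R]eq_bigr => x _ do rewrite departure_idle exit_arrival -/i -/(a x) mulrBl mul1r.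
under [X in (_ + X)%R]eq_bigr => x _ do rewrite -/(a x) mulrBl mul1r.
rewrite !sumrB exchange_big/=.
under eq_bigr => y _ do rewrite -mulr_suml.
have -> : (\sum_(x <- t) (\sum_(y <- t) p x y) * (i - a x) =
  i * (\sum_(x <- t) \sum_(y <- t) p x y) - \sum_(x <- t) (\sum_(y <- t) p x y) * a x)%R.
  by rewrite mulr_sumr -sumrB; apply: eq_bigr => x _; ring.
have -> : (\sum_(y <- t) (\sum_(x <- t) p x y) * (a y - i) =
  \sum_(y <- t) (\sum_(x <- t) p x y) * a y - i * (\sum_(x <- t) \sum_(y <- t) p x y))%R.
  by rewrite [in RHS]exchange_big mulr_sumr -sumrB/=; apply: eq_bigr => x _; ring.
ring.
Qed.

End sufficiency.

(** * Jumps between two sites *)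

Section two_site_flow.
Context (R : realType) (d : nat) (nu : probability (conf d) R) (mu : nat -> R).
Hypothesis nu_product : product_measure_on_sites nu.
Hypothesis nu_marginal : single_site_marginal nu mu.
Variable g : nat -> nat -> R.
Hypothesis g_ge0 : forall k n, 0 <= g k n.
Local Notation flow := (flow mu g).
Local Notation flow_integral := (flow_integral nu mu g).
Implicit Types (x y : lattice d).

(** For two independent sites of law mu, [inflow a b] is the rate of the
    jumps from the first site to the second that end in occupations (a, b),
    and [outflow a * mu b] the rate of those that start there. *)
Definition inflow (a b : nat) : R := \sum_(k < b.+1) flow k a * mu (b - k)%N.
Definition outflow (a : nat) : R := \sum_(k < a.+1) flow k (a - k)%N.

Let mu_ge0 := marginal_ge0 nu_marginal.
Let flow_ge0' k n : 0 <= flow k n := flow_ge0 nu_marginal g_ge0 k n.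
Local Open Scope ereal_scope.

(** Convolution: a final occupation b of the second site is the sum of its
    original occupation and of the number k of arriving particles. *)
Lemma flow_integral_inflow (F : nat -> nat -> conf d -> R) (K : nat -> nat -> \bar R) :
  (forall a b, 0 <= K a b) ->
  (forall k n, \int[nu]_eta (F k n eta)%:E =
               \esum_(m in setT) ((mu m)%:E * K n (m + k)%N)) ->
  flow_integral F = \esum_(i in [set: nat * nat]) ((inflow i.1 i.2)%:E * K i.1 i.2).
Proof.
move=> K0 FK.
have muK0 m n k : 0 <= (mu m)%:E * K n k by rewrite mule_ge0// lee_fin.
have fmK0 k a m n j : 0 <= (flow k a)%:E * ((mu m)%:E * K n j).
  by rewrite mule_ge0// lee_fin.
transitivity (\esum_(k in [set: nat]) \esum_(n in [set: nat]) \esum_(b in [set: nat])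
    (if (k <= b)%N then (flow k n)%:E * ((mu (b - k)%N)%:E * K n b) else 0)).
  rewrite /flow_integral esum_pair; last first.
    by move=> -[k n] /=; rewrite FK mule_ge0 ?lee_fin ?esum_ge0.
  apply: eq_esum => k _; apply: eq_esum => n _ /=; rewrite FK -ge0_esumZl//.
  rewrite -(esum_shift (fun b => (flow k n)%:E * ((mu (b - k)%N)%:E * K n b))).
  by apply: eq_esum => m _; rewrite addnK.
have cond0 (b : bool) (z : \bar R) : 0 <= z -> 0 <= (if b then z else 0) by case: b.
rewrite esum_exchange; last by move=> k n; apply: esum_ge0 => b _; exact: cond0.
rewrite [RHS]esum_pair; last first.
  move=> -[a b] /=; rewrite mule_ge0// lee_fin sumr_ge0// => k _; exact: mulr_ge0.
apply: eq_esum => n _; rewrite esum_exchange; last by move=> k b; exact: cond0.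
apply: eq_esum => b _ /=.
rewrite esum_initial// /inflow -sumEFin ge0_sume_distrl.
  by apply: eq_bigr => k _; rewrite EFinM muleA.
by move=> k _; rewrite lee_fin mulr_ge0.
Qed.

Lemma flow_integral_outflow (F : nat -> nat -> conf d -> R) (K : nat -> nat -> \bar R) :
  (forall a b, 0 <= K a b) ->
  (forall k n, \int[nu]_eta (F k n eta)%:E =
               \esum_(m in setT) ((mu m)%:E * K (n + k)%N m)) ->
  flow_integral F =
    \esum_(i in [set: nat * nat]) ((outflow i.1 * mu i.2)%:E * K i.1 i.2).
Proof.
move=> K0 FK.
have muK0 m n k : 0 <= (mu m)%:E * K n k by rewrite mule_ge0// lee_fin.
have fmK0 k a m n j : 0 <= (flow k a)%:E * ((mu m)%:E * K n j).
  by rewrite mule_ge0// lee_fin.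
have smuK0 n : 0 <= \esum_(m in [set: nat]) ((mu m)%:E * K n m) by exact: esum_ge0.
transitivity (\esum_(k in [set: nat]) \esum_(a in [set: nat])
    (if (k <= a)%N then
       (flow k (a - k)%N)%:E * \esum_(m in [set: nat]) ((mu m)%:E * K a m) else 0)).
  rewrite /flow_integral esum_pair; last first.
    by move=> -[k n] /=; rewrite FK mule_ge0 ?lee_fin.
  apply: eq_esum => k _ /=.
  rewrite -(esum_shift (fun a => (flow k (a - k)%N)%:E *
                          \esum_(m in [set: nat]) ((mu m)%:E * K a m))).
  by apply: eq_esum => n _; rewrite addnK FK.
have fs0 k a n : 0 <= (flow k a)%:E * \esum_(m in [set: nat]) ((mu m)%:E * K n m).
  by rewrite mule_ge0 ?lee_fin.
rewrite esum_exchange; last by move=> k n; case: ifP.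
have out0 a : (0 <= outflow a)%R by apply: sumr_ge0.
rewrite [RHS]esum_pair; last by move=> -[a b] /=; rewrite mule_ge0// lee_fin mulr_ge0.
apply: eq_esum => a _ /=.
rewrite esum_initial// -ge0_sume_distrl; last by move=> k _; rewrite lee_fin.
rewrite sumEFin -/(outflow a) -ge0_esumZl//.
by apply: eq_esum => b _; rewrite EFinM muleA.
Qed.

Section test_function.
Variable f : conf d -> R.
Hypothesis f_measurable : measurable_fun setT f.
Hypothesis f_ge0 : forall eta, (0 <= f eta)%R.

Let resampled (T : conf d -> conf d) x : measurable_fun setT T ->
  \int[nu]_eta (f (T eta))%:E =
  \esum_(m in setT) ((mu m)%:E * \int[nu]_eta (f (T (upd x m eta)))%:E).
Proof.
move=> mT; apply: (resample nu_product nu_marginal x (F := fun eta => (f (T eta))%:E)).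
  by apply/measurable_EFinP; exact: (measurableT_comp f_measurable mT).
by move=> eta; rewrite lee_fin.
Qed.

Let int_ge0 (T : conf d -> conf d) : 0 <= \int[nu]_eta (f (T eta))%:E.
Proof. by apply: integral_ge0 => eta _; rewrite lee_fin. Qed.

Let m_upd := @measurable_upd d.
Let m_gain := @measurable_gain d.

Lemma exchange_inflow x y : x != y ->
  exchange nu mu g f x y = \esum_(i in [set: nat * nat])
    ((inflow i.1 i.2)%:E * \int[nu]_eta (f (upd x i.1 (upd y i.2 eta)))%:E).
Proof.
move=> xy; rewrite /exchange ifN//.
apply: (flow_integral_inflow (K := fun a b => \int[nu]_eta (f (upd x a (upd y b eta)))%:E)) => //.
move=> k n; rewrite (resampled (T := fun eta => upd x n (gain y k eta)) y).
  by apply: eq_esum => m _; under eq_integral do rewrite gain_upd.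
by apply: measurableT_comp; [exact: m_upd|exact: m_gain].
Qed.

Lemma exchange_inflowC x y : x != y ->
  exchange nu mu g f y x = \esum_(i in [set: nat * nat])
    ((inflow i.2 i.1)%:E * \int[nu]_eta (f (upd x i.1 (upd y i.2 eta)))%:E).
Proof.
move=> xy; have yx : y != x by rewrite eq_sym.
rewrite (exchange_inflow yx).
rewrite (reindex_esum setT setT (fun i : nat * nat => (i.2, i.1))).
  by apply: eq_esum => -[a b] _ /=; under eq_integral do rewrite -updC//.
by split=> // [[a b] [a' b'] _ _ [-> ->]//|[a b] _]; exists (b, a).
Qed.

Lemma exit_rate_outflow x y : x != y ->
  exit_rate nu mu g f x = \esum_(i in [set: nat * nat])
    ((outflow i.1 * mu i.2)%:E * \int[nu]_eta (f (upd x i.1 (upd y i.2 eta)))%:E).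
Proof.
move=> xy.
apply: (flow_integral_outflow (K := fun a b => \int[nu]_eta (f (upd x a (upd y b eta)))%:E)) => //.
by move=> k n; rewrite (resampled (T := upd x (n + k)%N) y).
Qed.

Lemma exit_rate_outflowC x y : x != y ->
  exit_rate nu mu g f y = \esum_(i in [set: nat * nat])
    ((outflow i.2 * mu i.1)%:E * \int[nu]_eta (f (upd x i.1 (upd y i.2 eta)))%:E).
Proof.
move=> xy; have yx : y != x by rewrite eq_sym.
rewrite (exit_rate_outflow yx).
rewrite (reindex_esum setT setT (fun i : nat * nat => (i.2, i.1))).
  by apply: eq_esum => -[a b] _ /=; under eq_integral do rewrite -updC//.
by split=> // [[a b] [a' b'] _ _ [-> ->]//|[a b] _]; exists (b, a).
Qed.

Let esum_mu (c : \bar R) : c \is a fin_num -> 0 <= c ->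
  \esum_(m in [set: nat]) ((mu m)%:E * c) = c.
Proof.
move=> cfin c0; rewrite -(fineK cfin) ge0_esumZr.
- by rewrite (marginal_sum1 nu_marginal) mul1e.
- exact: fine_ge0.
- by move=> n; rewrite lee_fin.
Qed.

Hypothesis f_fin : forall T : conf d -> conf d, measurable_fun setT T ->
  \int[nu]_eta (f (T eta))%:E \is a fin_num.

Lemma departure_inflow x :
  departure nu mu g f x = \esum_(i in [set: nat * nat])
    ((inflow i.1 i.2)%:E * \int[nu]_eta (f (upd x i.1 eta))%:E).
Proof.
apply: (flow_integral_inflow (K := fun a _ => \int[nu]_eta (f (upd x a eta))%:E)) => //.
by move=> k n; rewrite esum_mu// f_fin.
Qed.

Lemma arrival_inflow x :
  arrival nu mu g f x = \esum_(i in [set: nat * nat])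
    ((inflow i.2 i.1)%:E * \int[nu]_eta (f (upd x i.1 eta))%:E).
Proof.
rewrite (reindex_esum setT setT (fun i : nat * nat => (i.2, i.1))).
  apply: (flow_integral_inflow (K := fun _ b => \int[nu]_eta (f (upd x b eta))%:E)) => //.
  move=> k n; rewrite (resampled (T := gain x k) x)//.
  by apply: eq_esum => m _; under eq_integral do rewrite gain_upd.
by split=> // [[a b] [a' b'] _ _ [-> ->]//|[a b] _]; exists (b, a).
Qed.

Lemma exit_rate_outflow1 x :
  exit_rate nu mu g f x = \esum_(i in [set: nat * nat])
    ((outflow i.1 * mu i.2)%:E * \int[nu]_eta (f (upd x i.1 eta))%:E).
Proof.
apply: (flow_integral_outflow (K := fun a _ => \int[nu]_eta (f (upd x a eta))%:E)) => //.
by move=> k n; rewrite esum_mu// f_fin.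
Qed.

Lemma idle_outflow x :
  idle nu mu g f = \esum_(i in [set: nat * nat])
    ((outflow i.2 * mu i.1)%:E * \int[nu]_eta (f (upd x i.1 eta))%:E).
Proof.
rewrite (reindex_esum setT setT (fun i : nat * nat => (i.2, i.1))).
  apply: (flow_integral_outflow (K := fun _ b => \int[nu]_eta (f (upd x b eta))%:E)) => //.
  by move=> k n; rewrite (resampled (T := id) x).
by split=> // [[a b] [a' b'] _ _ [-> ->]//|[a b] _]; exists (b, a).
Qed.

End test_function.
End two_site_flow.

(** * Symmetric kernels *)

Section balance.
Context (R : realType) (d : nat) (nu : probability (conf d) R) (mu : nat -> R).
Hypothesis nu_product : product_measure_on_sites nu.
Hypothesis nu_marginal : single_site_marginal nu mu.
Variable g : nat -> nat -> R.
Hypothesis g_ge0 : forall k n, 0 <= g k n.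
Hypothesis g_0 : forall n, g 0%N n = 0.
Hypothesis g_small : forall k n, (n < k)%N -> g k n = 0.
Variable p : lattice d -> lattice d -> R.
Hypothesis p_ge0 : forall x y, 0 <= p x y.
Hypothesis p_row : forall x, \esum_(y in setT) (p x y)%:E = 1%E.
Hypothesis p_col : forall y, \esum_(x in setT) (p x y)%:E = 1%E.
Local Notation flow := (flow mu g).
Local Notation flow_integral := (flow_integral nu mu g).
Local Notation inflow := (inflow mu g).
Local Notation outflow := (outflow mu g).
Hypothesis flow_finite :
  (\esum_(i in [set: nat * nat]) (flow i.1 i.2)%:E < +oo)%E.
Implicit Types (x y : lattice d).

Let mu_ge0 := marginal_ge0 nu_marginal.
Let flow_ge0' k n : 0 <= flow k n := flow_ge0 nu_marginal g_ge0 k n.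

Let inflow_ge0 a b : 0 <= inflow a b.
Proof. by apply: sumr_ge0 => k _; rewrite mulr_ge0. Qed.

Let outflow_ge0 a : 0 <= outflow a.
Proof. by apply: sumr_ge0. Qed.

(** The hypothesis says that mu x mu is stationary for the two-site process in
    which particles jump both ways at equal rates.  For symmetric p the jumps
    inside s come in such pairs, and a jump across the boundary of s can be
    paired as well, with an independent site of law mu. *)
Lemma balance_generator (f : conf d -> R) :
  symmetric_kernel p ->
  (forall a b, inflow a b + inflow b a = outflow a * mu b + outflow b * mu a) ->
  bounded_on setT f -> cylinder f ->
  (\int[nu]_eta (generator p (zrp_rates g) f eta)%:E = 0)%E.
Proof.
move=> psym balance; apply: integral_generator_eq0 => {}f B cf fB.
have mf := measurable_cylinder cf.
have f0 eta : 0 <= f eta by case/andP: (fB eta).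
have f_fin (T : conf d -> conf d) : measurable_fun setT T ->
    (\int[nu]_eta (f (T eta))%:E \is a fin_num)%E.
  move=> mT; rewrite ge0_fin_numE; last by apply: integral_ge0 => eta _; rewrite lee_fin.
  apply: (@bounded_integral_lty _ _ nu (f \o T) B); first exact: measurableT_comp.
  by move=> eta; exact: fB.
have balanced (K : nat -> nat -> \bar R) : (forall a b, 0 <= K a b)%E ->
    (\esum_(i in [set: nat * nat]) ((inflow i.1 i.2)%:E * K i.1 i.2) +
     \esum_(i in [set: nat * nat]) ((inflow i.2 i.1)%:E * K i.1 i.2) =
     \esum_(i in [set: nat * nat]) ((outflow i.1 * mu i.2)%:E * K i.1 i.2) +
     \esum_(i in [set: nat * nat]) ((outflow i.2 * mu i.1)%:E * K i.1 i.2))%E.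
  move=> K0; rewrite -!esumD; last 4 first.
  - by move=> i _; rewrite mule_ge0 ?lee_fin ?mulr_ge0.
  - by move=> i _; rewrite mule_ge0 ?lee_fin ?mulr_ge0.
  - by move=> i _; rewrite mule_ge0 ?lee_fin.
  - by move=> i _; rewrite mule_ge0 ?lee_fin.
  apply: eq_esum => -[a b] _ /=.
  by rewrite -!ge0_muleDl ?lee_fin ?mulr_ge0// -!EFinD balance.
have [E [X [D [A [Z [EE [EX ED] [EA EZ] gen]]]]]] := integral_generator_values nu_product
  nu_marginal g_ge0 g_0 g_small p_ge0 p_row p_col flow_finite cf fB.
have EC x y : E x y + E y x = X x + X y.
  have [->|xy] := eqVneq x y; first by apply: EFin_inj; rewrite !EFinD -EE -EX /exchange eqxx.
  apply: EFin_inj; rewrite !EFinD -!EE -!EX.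
  rewrite (exchange_inflow nu_product nu_marginal g_ge0 mf f0 xy).
  rewrite (exchange_inflowC nu_product nu_marginal g_ge0 mf f0 xy).
  rewrite (exit_rate_outflow nu_product nu_marginal g_ge0 mf f0 xy).
  rewrite (exit_rate_outflowC nu_product nu_marginal g_ge0 mf f0 xy).
  apply: (balanced (fun a b => \int[nu]_eta (f (upd x a (upd y b eta)))%:E)%E) => a b.
  by apply: integral_ge0 => eta _; rewrite lee_fin.
have DA x : D x + A x = X x + Z.
  apply: EFin_inj; rewrite !EFinD -ED -EA -EX -EZ.
  rewrite (departure_inflow nu_marginal g_ge0 f0 f_fin).
  rewrite (arrival_inflow nu_product nu_marginal g_ge0 mf f0 x).
  rewrite (exit_rate_outflow1 nu_marginal g_ge0 f0 f_fin).
  rewrite (idle_outflow nu_product nu_marginal g_ge0 mf f0 x).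
  apply: (balanced (fun a b => \int[nu]_eta (f (upd x a eta))%:E)%E) => a b.
  by apply: integral_ge0 => eta _; rewrite lee_fin.
have [s fs] := cf.
rewrite (gen (undup s)) ?undup_uniq//; last first.
  by move=> eta zeta h; apply: fs => x xs; apply: h; rewrite mem_undup.
congr (_%:E); set t := undup s.
rewrite -addrA -big_split/= [X in _ + X]big1 ?addr0; last first.
  move=> x _.
  under [X in _ + (1 - X) * _]eq_bigr do rewrite psym.
  rewrite -mulrDr; apply/eqP; rewrite mulf_eq0; apply/orP; right; apply/eqP.
  by have := DA x; lra.
set S := (X in X = 0); suff : S + S = 0 by lra.
rewrite /S {2}exchange_big/= -big_split big1// => x _.
rewrite -big_split big1//= => y _.
rewrite [p y x]psym -mulrDr.
by rewrite (_ : _ + _ = 0) ?mulr0//; have := EC x y; lra.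
Qed.

End balance.

(** * Necessity of the product condition *)

Section necessity.
Context (R : realType) (d : nat) (nu : probability (conf d) R) (mu : nat -> R).
Hypothesis nu_product : product_measure_on_sites nu.
Hypothesis nu_marginal : single_site_marginal nu mu.
Variable g : nat -> nat -> R.
Hypothesis g_ge0 : forall k n, 0 <= g k n.
Hypothesis g_0 : forall n, g 0%N n = 0.
Hypothesis g_small : forall k n, (n < k)%N -> g k n = 0.
Variable p : lattice d -> lattice d -> R.
Hypothesis p_ge0 : forall x y, 0 <= p x y.
Hypothesis p_row : forall x, \esum_(y in setT) (p x y)%:E = 1%E.
Hypothesis p_col : forall y, \esum_(x in setT) (p x y)%:E = 1%E.
Local Notation flow := (flow mu g).
Local Notation flow_integral := (flow_integral nu mu g).
Local Notation inflow := (inflow mu g).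
Local Notation outflow := (outflow mu g).
Hypothesis flow_finite :
  (\esum_(i in [set: nat * nat]) (flow i.1 i.2)%:E < +oo)%E.
Implicit Types (x y : lattice d).

Let mu_ge0 := marginal_ge0 nu_marginal.
Let flow_ge0' k n : 0 <= flow k n := flow_ge0 nu_marginal g_ge0 k n.

Let inflow_ge0 a b : 0 <= inflow a b.
Proof. by apply: sumr_ge0 => k _; rewrite mulr_ge0. Qed.

Let outflow_ge0 a : 0 <= outflow a.
Proof. by apply: sumr_ge0. Qed.


Let integral_indicator (A : set (conf d)) : measurable A ->
  (\int[nu]_eta (\1_A eta)%:E = nu A)%E.
Proof. by move=> mA; rewrite integral_indic// setIT. Qed.

Definition site_test x (a : nat) (eta : conf d) : R := (eta x == a)%:R.
Definition pair_test x y (a b : nat) (eta : conf d) : R :=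
  ((eta x == a) && (eta y == b))%:R.

Lemma site_test_integral x a : (\int[nu]_eta (site_test x a eta)%:E = (mu a)%:E)%E.
Proof.
rewrite -(@nu_marginal x a) -integral_indicator; last exact: measurable_site.
apply: eq_integral => eta _; rewrite /site_test indicE; congr ((_ : bool)%:R%:E).
by apply/eqP/idP => [?|]; rewrite inE.
Qed.

Lemma pair_test_integral x y a b : x != y ->
  (\int[nu]_eta (pair_test x y a b eta)%:E = (mu a * mu b)%:E)%E.
Proof.
move=> xy; have yx : y != x by rewrite eq_sym.
pose n z : nat := if z == x then a else b.
have uxy : uniq [:: x; y] by rewrite /= inE xy.
have := nu_product n uxy; rewrite !big_cons big_nil mule1 !nu_marginal.
rewrite /n eqxx (negPf yx) -EFinM => <-.
rewrite -integral_indicator; last first.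
  apply: (@measurable_cylinder_set _ [:: x; y]) => eta zeta h /= e z zs.
  by rewrite -h// e.
apply: eq_integral => eta _; rewrite /pair_test indicE; congr ((_ : bool)%:R%:E).
apply/andP/idP => [[/eqP ex /eqP ey]|].
  rewrite inE /= => z; rewrite !inE => /orP[/eqP ->|/eqP ->]; first by rewrite eqxx.
  by rewrite (negPf yx).
rewrite inE /= => h; rewrite !h ?inE ?eqxx ?orbT//.
by rewrite (negPf yx) eqxx.
Qed.

Lemma pair_testC x y a b : pair_test x y a b = pair_test y x b a.
Proof. by apply/funext => eta; rewrite /pair_test andbC. Qed.

Lemma cylinder_site_test x a (eta zeta : conf d) :
  (forall z, z \in [:: x] -> eta z = zeta z) -> site_test x a eta = site_test x a zeta.
Proof. by move=> h; rewrite /site_test h ?inE. Qed.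

Lemma cylinder_pair_test x y a b (eta zeta : conf d) :
  (forall z, z \in [:: x; y] -> eta z = zeta z) ->
  pair_test x y a b eta = pair_test x y a b zeta.
Proof. by move=> h; rewrite /pair_test !h ?inE ?eqxx ?orbT. Qed.

Let bool_bounds (b : bool) : (0 <= (b%:R : R)) && ((b%:R : R) <= 1).
Proof. by case: b; rewrite ?lexx ?ler01. Qed.

(** The rates at which a site of law mu ends with a particles, after losing
    some ([down_rate]) or after receiving some ([up_rate]). *)
Definition down_rate (a : nat) : \bar R := \esum_(k in setT) (flow k a)%:E.
Definition up_rate (a : nat) : \bar R := \esum_(i in [set: nat * nat])
  ((flow i.1 i.2)%:E * (if (i.1 <= a)%N then mu (a - i.1)%N else 0)%:E)%E.

Lemma flow_integral_down (F : nat -> nat -> conf d -> R) a c : 0 <= c ->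
  (forall k n, \int[nu]_eta (F k n eta)%:E = ((n == a)%:R * c)%:E)%E ->
  (flow_integral F = down_rate a * c%:E)%E.
Proof.
move=> c0 Fc; rewrite /flow_integral esum_pair; last first.
  by move=> -[k n] /=; rewrite Fc -EFinM lee_fin !mulr_ge0.
rewrite -ge0_esumZr//; last by move=> k; rewrite lee_fin.
apply: eq_esum => k _; rewrite (esum_single (t := a)).
- by rewrite /= Fc eqxx mul1r.
- by rewrite /= Fc -EFinM lee_fin !mulr_ge0.
- by move=> n /negPf na; rewrite /= Fc na mul0r mule0.
Qed.

Lemma flow_integral_up (F : nat -> nat -> conf d -> R) a c : 0 <= c ->
  (forall k n, \int[nu]_eta (F k n eta)%:E =
     ((if (k <= a)%N then mu (a - k)%N else 0) * c)%:E)%E ->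
  (flow_integral F = up_rate a * c%:E)%E.
Proof.
move=> c0 Fc; rewrite -ge0_esumZr//; last first.
  by move=> k; rewrite -EFinM lee_fin mulr_ge0//; case: ifP.
by apply: eq_esum => -[k n] _ /=; rewrite Fc -!EFinM mulrA.
Qed.

Let total := fine (\esum_(i in [set: nat * nat]) (flow i.1 i.2)%:E)%E.

Lemma flow_integral_const (F : nat -> nat -> conf d -> R) c : 0 <= c ->
  (forall k n, \int[nu]_eta (F k n eta)%:E = c%:E)%E ->
  (flow_integral F = (total * c)%:E)%E.
Proof.
move=> c0 Fc; rewrite EFinM /total fineK; last by apply: esum_fin_num => // i; rewrite lee_fin.
rewrite -ge0_esumZr//; last by move=> k; rewrite lee_fin.
by apply: eq_esum => -[k n] _ /=; rewrite Fc.
Qed.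

Let site_gain x a k : (\int[nu]_eta (site_test x a (gain x k eta))%:E =
   (if (k <= a)%N then mu (a - k)%N else 0)%:E)%E.
Proof.
case: ifPn => ka.
  rewrite -(site_test_integral x); apply: eq_integral => eta _.
  by rewrite /site_test /gain upd_same -{1}(subnK ka) eqn_add2r.
rewrite integral0_eq// => eta _; rewrite /site_test /gain upd_same.
by rewrite gtn_eqF// (leq_trans _ (leq_addl _ _)) ?ltnNge.
Qed.

Let pair_gain x y a b k : x != y -> (\int[nu]_eta (pair_test x y a b (gain x k eta))%:E =
   ((if (k <= a)%N then mu (a - k)%N else 0) * mu b)%:E)%E.
Proof.
move=> xy; have yx : y != x by rewrite eq_sym.
case: ifPn => ka.
  rewrite -(pair_test_integral _ _ xy); apply: eq_integral => eta _.
  by rewrite /pair_test /gain upd_same upd_other// -{1}(subnK ka) eqn_add2r.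
rewrite mul0r integral0_eq// => eta _; rewrite /pair_test /gain upd_same.
by rewrite gtn_eqF// (leq_trans _ (leq_addl _ _)) ?ltnNge.
Qed.

Let pair_upd x y a b n : x != y -> (\int[nu]_eta (pair_test x y a b (upd x n eta))%:E =
   ((n == a)%:R * mu b)%:E)%E.
Proof.
move=> xy; have yx : y != x by rewrite eq_sym.
have [na|na] := eqVneq n a; last first.
  rewrite mul0r integral0_eq// => eta _.
  by rewrite /pair_test upd_same (negPf na).
rewrite mul1r -(site_test_integral y); apply: eq_integral => eta _.
by rewrite /pair_test upd_same upd_other// na eqxx.
Qed.

Let cyl_site x a : cylinder (site_test x a).
Proof. by exists [:: x]; exact: cylinder_site_test. Qed.

Let cyl_pair x y a b : cylinder (pair_test x y a b).
Proof. by exists [:: x; y]; exact: cylinder_pair_test. Qed.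

Let msite x a := measurable_cylinder (cyl_site x a).
Let mpair x y a b := measurable_cylinder (cyl_pair x y a b).

Let fin_test (f : conf d -> R) : measurable_fun setT f ->
  (forall eta, 0 <= f eta <= 1) -> forall T : conf d -> conf d,
  measurable_fun setT T -> (\int[nu]_eta (f (T eta))%:E \is a fin_num)%E.
Proof.
move=> mf f01 T mT; rewrite ge0_fin_numE; last first.
  by apply: integral_ge0 => eta _; rewrite lee_fin; case/andP: (f01 (T eta)).
apply: (@bounded_integral_lty _ _ nu (f \o T) 1); first exact: measurableT_comp.
by move=> eta; exact: f01.
Qed.

Let site_upd x a n : (\int[nu]_eta (site_test x a (upd x n eta))%:E = (n == a)%:R%:E)%E.
Proof.
under eq_integral do rewrite /site_test upd_same.
by rewrite integral_cst//= probability_setT mule1.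
Qed.

Lemma departure_site_test x a : (departure nu mu g (site_test x a) x = down_rate a)%E.
Proof.
rewrite -[RHS]mule1; apply: flow_integral_down => // k n.
by rewrite site_upd mulr1.
Qed.

Lemma arrival_site_test x a : (arrival nu mu g (site_test x a) x = up_rate a)%E.
Proof.
rewrite -[RHS]mule1; apply: flow_integral_up => // k n.
by rewrite site_gain mulr1.
Qed.

Lemma idle_site_test x a : idle nu mu g (site_test x a) = (total * mu a)%:E.
Proof. by apply: flow_integral_const => // k n; exact: site_test_integral. Qed.

Lemma exit_rate_site_test x a : exit_rate nu mu g (site_test x a) x = (outflow a)%:E.
Proof.
have s01 eta : 0 <= site_test x a eta <= 1 by exact: bool_bounds.
have s0 eta : 0 <= site_test x a eta by case/andP: (s01 eta).
rewrite (exit_rate_outflow1 nu_marginal g_ge0 s0 (fin_test (@msite x a) s01)).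
under eq_esum do rewrite site_upd.
rewrite esum_pair; last first.
  by move=> -[b c] /=; rewrite -EFinM lee_fin !mulr_ge0.
rewrite (esum_single (t := a)) /=.
- rewrite eqxx; under eq_esum do rewrite mulr1n mule1 EFinM.
  rewrite ge0_esumZl//.
  by rewrite (marginal_sum1 nu_marginal) mule1.
- by apply: esum_ge0 => b _; rewrite -EFinM lee_fin !mulr_ge0.
- by move=> b /negPf ba; apply: esum1 => c _; rewrite ba mule0.
Qed.

Lemma departure_pair_test x y a b : x != y ->
  (departure nu mu g (pair_test x y a b) x = down_rate a * (mu b)%:E)%E.
Proof. by move=> xy; apply: flow_integral_down => // k n; exact: pair_upd. Qed.

Lemma arrival_pair_test x y a b : x != y ->
  (arrival nu mu g (pair_test x y a b) x = up_rate a * (mu b)%:E)%E.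
Proof. by move=> xy; apply: flow_integral_up => // k n; exact: pair_gain. Qed.

Lemma idle_pair_test x y a b : x != y ->
  idle nu mu g (pair_test x y a b) = (total * (mu a * mu b))%:E.
Proof.
move=> xy; apply: flow_integral_const; first exact: mulr_ge0.
by move=> k n; exact: pair_test_integral.
Qed.

Let pair_upd_upd x y a b i j : x != y ->
  (\int[nu]_eta (pair_test x y a b (upd x i (upd y j eta)))%:E =
   ((i == a) && (j == b))%:R%:E)%E.
Proof.
move=> xy; have yx : y != x by rewrite eq_sym.
under eq_integral do rewrite /pair_test upd_same upd_other// upd_same.
by rewrite integral_cst//= probability_setT mule1.
Qed.

Lemma exchange_pair_test x y a b : x != y ->
  exchange nu mu g (pair_test x y a b) x y = (inflow a b)%:E.
Proof.
move=> xy; have s01 eta : 0 <= pair_test x y a b eta <= 1 by exact: bool_bounds.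
have s0 eta : 0 <= pair_test x y a b eta by case/andP: (s01 eta).
rewrite (exchange_inflow nu_product nu_marginal g_ge0 (@mpair x y a b) s0 xy).
rewrite (esum_single (t := (a, b))) /=.
- by rewrite pair_upd_upd// !eqxx mule1.
- by rewrite pair_upd_upd// -EFinM lee_fin mulr_ge0.
- move=> [i j] /=; rewrite xpair_eqE pair_upd_upd// => /negPf ->.
  by rewrite mule0.
Qed.

Lemma exit_rate_pair_test x y a b : x != y ->
  exit_rate nu mu g (pair_test x y a b) x = (outflow a * mu b)%:E.
Proof.
move=> xy; have s01 eta : 0 <= pair_test x y a b eta <= 1 by exact: bool_bounds.
have s0 eta : 0 <= pair_test x y a b eta by case/andP: (s01 eta).
rewrite (exit_rate_outflow nu_product nu_marginal g_ge0 (@mpair x y a b) s0 xy).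
rewrite (esum_single (t := (a, b))) /=.
- by rewrite pair_upd_upd// !eqxx mule1.
- by rewrite pair_upd_upd// -EFinM lee_fin !mulr_ge0.
- move=> [i j] /=; rewrite xpair_eqE pair_upd_upd// => /negPf ->.
  by rewrite mule0.
Qed.

(** Comparing the hypothesis for a and for 0 gives a triangular system for
    the differences mu 0 * flow k a - mu a * flow k 0, with mu 0 on the
    diagonal. *)
Lemma product_condition_of_flow : 0 < mu 0%N ->
  (forall a b, inflow a b = outflow b * mu a) ->
  product_condition g mu.
Proof.
move=> mu0 io k a k1 a1; have nz : mu 0%N != 0 by rewrite gt_eqF.
have flow0 n : flow 0 n = 0 by rewrite /flow g_0 mul0r.
suff h m : mu 0%N * flow m a = mu a * flow m 0.
  apply: (mulfI nz); rewrite -/(flow k a) h /flow add0n; field.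
  exact: nz.
elim/ltn_ind: m => m IH.
have : mu 0%N * inflow a m = mu a * inflow 0 m by rewrite !io; ring.
rewrite /inflow !big_ord_recr/= subnn !mulrDr !mulr_sumr.
rewrite (eq_bigr (fun j : 'I_m => mu a * (flow j 0 * mu (m - j)%N))); last first.
  by move=> j _; rewrite mulrA IH// -mulrA.
move/addrI; rewrite !mulrA => /(mulIf nz) //.
Qed.

(** Testing on the occupations of one site, then of two sites x and y with
    p x y <> p y x. *)
Lemma generator_product_condition :
  0 < mu 0%N -> asymmetric_kernel p ->
  (forall f : conf d -> R, bounded_on setT f -> cylinder f ->
     \int[nu]_eta (generator p (zrp_rates g) f eta)%:E = 0)%E ->
  product_condition g mu.
Proof.
move=> mu0 asym gen0.
have [x [y pxy]] : exists x y, p x y <> p y x.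
  by apply: contra_notP asym => h x y; apply: contra_notP h => h; exists x, y.
have xy : x != y by apply/eqP => e; apply: pxy; rewrite e.
have yx : y != x by rewrite eq_sym.
have bnd (f : conf d -> R) : (forall eta, 0 <= f eta <= 1) -> bounded_on setT f.
  by move=> f01; exists 1 => eta _; have /andP[? ?] := f01 eta; rewrite ger0_norm.
have s01 z a eta : 0 <= site_test z a eta <= 1 by exact: bool_bounds.
have d01 z w a b eta : 0 <= pair_test z w a b eta <= 1 by exact: bool_bounds.
have [D ED] : exists D, forall a, down_rate a = (D a)%:E.
  exists (fun a => fine (down_rate a)) => a; rewrite fineK// -(departure_site_test 0).
  exact: (departure_fin_num nu_marginal g_ge0 flow_finite (cyl_site 0 a) (s01 0 a)).
have [U EU] : exists U, forall a, up_rate a = (U a)%:E.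
  exists (fun a => fine (up_rate a)) => a; rewrite fineK// -(arrival_site_test 0).
  exact: (arrival_fin_num nu_marginal g_ge0 flow_finite (cyl_site 0 a) (s01 0 a)).
(* some site is left with positive probability *)
have [z pz] : exists z, p z z != 1.
  have offdiag u v : u != v -> p u u = 1 -> p u v = 0.
    move=> uv puu; have uuv : uniq [:: u; v] by rewrite /= inE uv.
    have := outside_sum uuv (p_ge0 u) (p_row u).
    rewrite !big_cons big_nil addr0 puu => e.
    have : (0 <= (1 - (1 + p u v))%:E)%E.
      by rewrite -e; apply: esum_ge0 => w _; rewrite lee_fin.
    by rewrite lee_fin; have := p_ge0 u v; lra.
  have [/eqP px|] := boolP (p x x == 1); last by exists x.
  have [/eqP py|] := boolP (p y y == 1); last by exists y.
  by case: pxy; rewrite (offdiag x y xy px) (offdiag y x yx py).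
have site_eq a : U a = outflow a + total * mu a - D a.
  have [E [X [De [A [Z [EE [EX ED'] [EA EZ] gen]]]]]] := integral_generator_values nu_product
    nu_marginal g_ge0 g_0 g_small p_ge0 p_row p_col flow_finite (cyl_site z a) (s01 z a).
  have := gen [:: z] isT (@cylinder_site_test z a).
  rewrite gen0; [|exact: bnd (s01 z a)|exact: cyl_site].
  rewrite !big_seq1 => -[e].
  have Xz : X z = outflow a by apply: EFin_inj; rewrite -EX exit_rate_site_test.
  have Ez : E z z = X z by apply: EFin_inj; rewrite -EE -EX /exchange eqxx.
  have Dz : De z = D a by apply: EFin_inj; rewrite -ED' departure_site_test ED.
  have Az : A z = U a by apply: EFin_inj; rewrite -EA arrival_site_test EU.
  have Zz : Z = total * mu a by apply: EFin_inj; rewrite -EZ idle_site_test.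
  have : (1 - p z z) * (U a - (outflow a + total * mu a - D a)) = 0.
    by rewrite [RHS]e Ez Xz Dz Az Zz; ring.
  move=> /eqP; rewrite mulf_eq0 subr_eq0 eq_sym (negPf pz) /= subr_eq0.
  by move/eqP.
(* the terms of the two-site equation that survive [site_eq] *)
pose W a b := inflow a b - D a * mu b - mu a * outflow b + mu a * D b.
have pair_eq a b : p x y * W a b + p y x * W b a = 0.
  have uxy : uniq [:: x; y] by rewrite /= inE xy.
  have [E [X [De [A [Z [EE [EX ED'] [EA EZ] gen]]]]]] := integral_generator_values nu_product
    nu_marginal g_ge0 g_0 g_small p_ge0 p_row p_col flow_finite (cyl_pair x y a b) (d01 x y a b).
  have := gen [:: x; y] uxy (@cylinder_pair_test x y a b).
  rewrite gen0; [|exact: bnd (d01 x y a b)|exact: cyl_pair].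
  rewrite !big_cons !big_nil => -[e].
  have Exx u : E u u = X u by apply: EFin_inj; rewrite -EE -EX /exchange eqxx.
  have Exy : E x y = inflow a b by apply: EFin_inj; rewrite -EE exchange_pair_test.
  have Xx : X x = outflow a * mu b by apply: EFin_inj; rewrite -EX exit_rate_pair_test.
  have Dx : De x = D a * mu b.
    by apply: EFin_inj; rewrite -ED' departure_pair_test// ED EFinM.
  have Ax : A x = U a * mu b by apply: EFin_inj; rewrite -EA arrival_pair_test// EU EFinM.
  have Zxy : Z = total * (mu a * mu b) by apply: EFin_inj; rewrite -EZ idle_pair_test.
  rewrite pair_testC in EE EX ED' EA.
  have Eyx : E y x = inflow b a by apply: EFin_inj; rewrite -EE exchange_pair_test.
  have Xy : X y = outflow b * mu a by apply: EFin_inj; rewrite -EX exit_rate_pair_test.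
  have Dy : De y = D b * mu a.
    by apply: EFin_inj; rewrite -ED' departure_pair_test// ED EFinM.
  have Ay : A y = U b * mu a by apply: EFin_inj; rewrite -EA arrival_pair_test// EU EFinM.
  rewrite [RHS]e !Exx Exy Eyx Xx Xy Dx Dy Ax Ay Zxy !site_eq /W; ring.
have W0 a b : W a b = 0.
  have h1 := pair_eq a b; have h2 := pair_eq b a.
  have : (p x y - p y x) * ((p x y + p y x) * W a b) = 0.
    by rewrite -[RHS](subrr 0) -{1}(mulr0 (p x y)) -{1}h1 -(mulr0 (p y x)) -h2; ring.
  have px := p_ge0 x y; have py := p_ge0 y x.
  move=> /eqP; rewrite !mulf_eq0 subr_eq0 => /orP[/eqP//|/orP[|/eqP//]].
  rewrite paddr_eq0// => /andP[/eqP p1 /eqP p2].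
  by case: pxy; rewrite p1 p2.
have out0 : outflow 0 = 0 by rewrite /outflow big_ord_recl big_ord0 /flow g_0 mul0r addr0.
have in0 a : inflow a 0 = 0 by rewrite /inflow big_ord_recl big_ord0 /flow g_0 !mul0r addr0.
apply: product_condition_of_flow => // a b.
have nz : mu 0%N != 0 by rewrite gt_eqF.
have D0 c : D c = mu c * (D 0%N / mu 0%N).
  have := W0 c 0%N; rewrite /W in0 out0 => e.
  apply: (mulIf nz); rewrite -mulrA divfK//; lra.
have := W0 a b; rewrite /W (D0 a) (D0 b); lra.
Qed.

End necessity.

(** * Functions with zero right derivative *)

Section right_derivative.
Context (R : realType).

(** The set of t such that phi stays within slope e on [0, t] is closed by
    continuity, and open to the right by the hypothesis on the derivative;
    hence it is everything, for each e > 0. *)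
Lemma constant_of_right_derivative (phi : R -> R) :
  (forall t, 0 < t -> {for t, continuous phi}) ->
  (forall t, 0 <= t -> (phi (t + u) - phi t) / u @[u --> 0^'+] --> 0) ->
  forall t, 0 <= t -> phi t = phi 0.
Proof.
move=> cphi dphi T; rewrite le_eqVlt => /predU1P[<-//|T0].
suff slope e : 0 < e -> `|phi T - phi 0| <= e * T.
  apply/eqP; rewrite -subr_eq0 -normr_le0; apply/ler_addgt0Pr => e e0.
  by rewrite add0r (le_trans (slope (e / T) _)) ?divr_gt0// divfK ?gt_eqF.
move=> e0; pose A := [set t | 0 <= t <= T /\
  forall r, 0 <= r <= t -> `|phi r - phi 0| <= e * r].
have A0 : A 0.
  split; first by rewrite lexx ltW.
  by move=> r /le_anti <-; rewrite subrr normr0 mulr0.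
have ubA : ubound A T by move=> t [/andP[]].
have supA : has_sup A by split; [exists 0|exists T].
have c0 : 0 <= sup A by apply: ub_le_sup => //; exists T.
have cT : sup A <= T by apply: ge_sup => //; exists 0.
set c := sup A in c0 cT *.
have below r : 0 <= r < c -> `|phi r - phi 0| <= e * r.
  move=> /andP[r0 rc]; have cr : 0 < c - r by rewrite subr_gt0.
  have [t [_ At] crt] := sup_adherent cr supA.
  by apply: At; rewrite r0 /= ltW// -[r](subKr c).
have Ac r : 0 <= r <= c -> `|phi r - phi 0| <= e * r.
  move=> /andP[r0]; rewrite le_eqVlt => /predU1P[rc|rc]; last first.
    by apply: below; rewrite r0.
  rewrite {r}rc in r0 *; move: r0; rewrite le_eqVlt => /predU1P[<-|c_gt0].
    by rewrite subrr normr0 mulr0.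
  rewrite -subr_le0.
  apply: (@cvgr_to_le _ (c^'-) _ _ (fun r => `|phi r - phi 0| - e * r)).
    apply: cvgB; last by apply: cvgMl_tmp; apply: cvg_at_left_filter; exact: cvg_id.
    apply: cvg_norm; apply: cvgB; last exact: cvg_cst.
    by apply: cvg_at_left_filter; exact: cphi.
  near=> r; rewrite subr_le0; apply: below; apply/andP; split; near: r.
    exact: nbhs_left_ge.
  exact: nbhs_left_lt.
move: cT; rewrite le_eqVlt => /predU1P[cT|cT].
  by rewrite -cT; apply: Ac; rewrite cT lexx ltW// -cT.
have [del del0 hdel] := cvgr0_norm_lt _ (dphi c c0) _ e0.
pose w := Num.min (del / 2) (T - c).
have w0 : 0 < w by rewrite lt_min divr_gt0//= subr_gt0.
have wdel : w < del by rewrite gt_min ltr_pdivrMr// ltr_pMr// ltr1n.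
have wT : c + w <= T by rewrite addrC -lerBrDr ge_min lexx orbT.
suff : A (c + w).
  by move=> /(ub_le_sup (ex_intro _ T ubA)); rewrite -/c gerDl leNgt w0.
split; first by rewrite wT addr_ge0// ltW.
move=> r /andP[r0 rw]; have [rc|cr] := leP r c; first by apply: Ac; rewrite r0.
have u0 : 0 < r - c by rewrite subr_gt0.
have := hdel (r - c); rewrite /= sub0r normrN (gtr0_norm u0) => /(_ _ u0) hr.
have {}hr : `|phi r - phi c| <= e * (r - c).
  have := hr; rewrite subrKC normrM normfV (gtr0_norm u0) ltr_pdivrMr// => h.
  by apply/ltW/h; rewrite ltrBlDl (le_lt_trans rw)// ltrD2l.
rewrite -(subrKA (phi c)) (le_trans (ler_normD _ _))//.
have -> : e * r = e * (r - c) + e * c by ring.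
by apply: lerD => //; apply: Ac; rewrite lexx c0.
Unshelve. all: by end_near. Qed.

End right_derivative.

(** * Dominated convergence for signed sums *)

Section rsum_convergence.
Context (R : realType) (I : countType).
Local Open Scope ereal_scope.

(** [rsum] is an integral for the counting measure, which gives access to
    dominated convergence. *)
Lemma rsum_counting (A : set I) (u : I -> R) :
  rsum A u = fine (\int[counting]_n coded A (EFin \o u) n).
Proof.
rewrite /rsum integralE; congr (fine (_ - _)).
- rewrite ge0_integral_count => [|n]; last exact: funepos_ge0.
  rewrite esum_coded => [|i]; last exact: funepos_ge0.
  apply: eq_eseriesr => n _; rewrite funeposE /coded.
  by case: (pickle_inv n) => [i|]; [case: ifP|]; rewrite ?funeposE ?maxxx.
- rewrite ge0_integral_count => [|n]; last exact: funeneg_ge0.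
  rewrite esum_coded => [|i]; last exact: funeneg_ge0.
  apply: eq_eseriesr => n _; rewrite funenegE /coded.
  by case: (pickle_inv n) => [i|]; [case: ifP|]; rewrite ?funenegE ?oppe0 ?maxxx.
Qed.

Lemma rsum_cvg (A : set I) (u_ : nat -> I -> R) (u b : I -> R) :
  (forall i, A i -> u_ ^~ i @ \oo --> u i) ->
  (forall n i, A i -> `|u_ n i| <= b i)%R -> (forall i, 0 <= b i)%R ->
  \esum_(i in A) (b i)%:E < +oo ->
  rsum A (u_ n) @[n --> \oo] --> rsum A u.
Proof.
move=> uu ub b0 boo; pose c := counting : {measure set nat -> \bar R}.
have b0' i : 0 <= (EFin \o b) i by rewrite lee_fin.
have intb : c.-integrable setT (coded A (EFin \o b)).
  apply/integrableP; split=> //.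
  under eq_integral do rewrite gee0_abs ?coded_ge0//.
  by rewrite ge0_integral_count -?esum_coded// => n; exact: coded_ge0.
have mcoded (a : I -> \bar R) : measurable_fun setT (coded A a) by [].
have cu : {ae c, forall n, setT n ->
    (fun k => coded A (EFin \o u_ k) n) @ \oo --> coded A (EFin \o u) n}.
  apply: aeW => n _; rewrite /coded; case: (pickle_inv n) => [i|]; last exact: cvg_cst.
  case: ifP => [/set_mem Ai|_]; last exact: cvg_cst.
  by apply: cvg_EFin; [apply: nearW|exact: uu].
have cb : {ae c, forall n k, setT n ->
    `|coded A (EFin \o u_ k) n| <= coded A (EFin \o b) n}.
  apply: aeW => n k _; rewrite /coded; case: (pickle_inv n) => [i|]; last by rewrite abse0.
  by case: ifP => [/set_mem Ai|_]; [rewrite lee_fin ub|rewrite abse0].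
have [intu _] := dominated_convergence measurableT (fun k => mcoded (EFin \o u_ k))
  (mcoded (EFin \o u)) cu intb cb.
have fin_u := integrable_fin_num measurableT intu.
rewrite -(fineK fin_u) => /fine_cvg.
rewrite [in X in X -> _]/comp /= -rsum_counting => cvu.
by under eq_fun do rewrite rsum_counting.
Qed.

Lemma abs_rsum_le (A : set I) (u b : I -> R) :
  (forall i, A i -> `|u i| <= b i)%R -> (forall i, 0 <= b i)%R ->
  `|rsum A u|%:E <= \esum_(i in A) (b i)%:E.
Proof.
move=> ub b0; have [boo|] := ltP (\esum_(i in A) (b i)%:E) +oo; last first.
  by rewrite leye_eq => /eqP ->; rewrite leey.
rewrite /rsum.
set P := \esum_(i in A) _; set N := \esum_(i in A) _.
have P0 : 0 <= P by apply: esum_ge0 => i _; exact: funepos_ge0.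
have N0 : 0 <= N by apply: esum_ge0 => i _; exact: funeneg_ge0.
have PN : P + N <= \esum_(i in A) (b i)%:E.
  rewrite -esumD; last 2 first.
  - by move=> i _; exact: funepos_ge0.
  - by move=> i _; exact: funeneg_ge0.
  apply: le_esum => i Ai; have /= <- := congr1 (fun h => h i) (fune_abse (EFin \o u)).
  by rewrite lee_fin ub.
have Pfin : P \is a fin_num.
  by rewrite ge0_fin_numE// (le_lt_trans _ boo)// (le_trans _ PN)// leeDl.
have Nfin : N \is a fin_num.
  by rewrite ge0_fin_numE// (le_lt_trans _ boo)// (le_trans _ PN)// leeDr.
apply: le_trans PN; rewrite -(fineK Pfin) -(fineK Nfin) -EFinB -EFinD lee_fin /=.
have p0 : (0 <= fine P)%R by exact: fine_ge0.
have n0 : (0 <= fine N)%R by exact: fine_ge0.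
by rewrite ler_norml; apply/andP; split; lra.
Qed.

End rsum_convergence.

(** * The weighted norm and Lipschitz functions *)

Section weighted_norm.
Context (R : realType) (d : nat) (a : lattice d -> R).
Hypothesis a_gt0 : forall x, 0 < a x.
Implicit Types (x y : lattice d) (eta zeta : conf d).

Let a_ge0 x : 0 <= a x. Proof. exact: ltW. Qed.

Lemma wnorm_ge0 eta : (0 <= wnorm a eta)%E.
Proof. by apply: esum_ge0 => x _; rewrite lee_fin mulr_ge0. Qed.

Lemma wdist_ge0 eta zeta : (0 <= wdist a eta zeta)%E.
Proof. by apply: esum_ge0 => x _; rewrite lee_fin mulr_ge0. Qed.

Lemma wnorm_triangle eta zeta : (wnorm a eta <= wnorm a zeta + wdist a eta zeta)%E.
Proof.
rewrite -esumD; last 2 first.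
- by move=> x _; rewrite lee_fin mulr_ge0.
- by move=> x _; rewrite lee_fin mulr_ge0.
apply: le_esum => x _; rewrite -EFinD lee_fin -mulrDl ler_wpM2r//.
have := ler_norm ((eta x)%:R - (zeta x)%:R : R); lra.
Qed.

(** The two configurations differ only at x and at y, by k particles. *)
Lemma wdist_jump k x y eta :
  (wdist a (jump k x y eta) eta <= (k%:R * (a x + a y))%:E)%E.
Proof.
have spike0 (u z : lattice d) : (0 <= (if z == u then k%:R * a u else 0)%:E)%E.
  by case: ifP => _; rewrite lee_fin// mulr_ge0.
have spike (u : lattice d) :
    (\esum_(z in setT) (if z == u then k%:R * a u else 0)%:E = (k%:R * a u)%:E)%E.
  by rewrite (esum_single (t := u)) ?eqxx// => [|z /negPf ->//]; rewrite lee_fin mulr_ge0.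
rewrite mulrDr EFinD -(spike x) -(spike y) -esumD//.
apply: le_esum => z _; rewrite -EFinD lee_fin /jump.
have sx : 0 <= (if z == x then k%:R * a x else 0) :> R by case: ifP => _; rewrite ?mulr_ge0.
have sy : 0 <= (if z == y then k%:R * a y else 0) :> R by case: ifP => _; rewrite ?mulr_ge0.
case: ifPn => [/andP[kx xy]|_]; last by rewrite subrr normr0 mul0r addr_ge0.
have [->|zx] := eqVneq z x.
  rewrite natrB// (negPf xy) addr0 addrAC subrr sub0r normrN ger0_norm//.
have [->|zy] := eqVneq z y; last by rewrite subrr normr0 mul0r addr0.
by rewrite natrD addrAC subrr !add0r ger0_norm.
Qed.

Lemma finite_norm_jump k x y eta : finite_norm a eta -> finite_norm a (jump k x y eta).
Proof.
move=> fin; apply: le_lt_trans (wnorm_triangle _ eta) _.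
by rewrite lte_add_pinfty// (le_lt_trans (wdist_jump k x y eta))// ltry.
Qed.

(** The boxes are given by a coding of the lattice, since only their being
    finite and exhausting matters. *)
Definition restr (n : nat) eta : conf d := fun x => if (pickle x < n)%N then eta x else 0%N.

Lemma finite_norm_restr n eta : finite_norm a eta -> finite_norm a (restr n eta).
Proof.
apply: le_lt_trans; apply: le_esum => x _; rewrite lee_fin ler_wpM2r// ler_nat.
by rewrite /restr; case: ifP.
Qed.

Lemma wdist_restr n eta zeta :
  (wdist a (restr n eta) (restr n zeta) <= wdist a eta zeta)%E.
Proof.
apply: le_esum => x _; rewrite lee_fin ler_wpM2r// /restr.
by case: ifP => // _; rewrite subrr normr0.
Qed.

Lemma cylinder_restr (h : conf d -> R) n : cylinder (h \o restr n).
Proof.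
exists (pmap unpickle (iota 0 n)) => eta zeta e /=; congr h; apply/funext => x.
rewrite /restr; case: ifPn => // xn; apply: e.
by rewrite mem_pmap; apply/mapP; exists (pickle x); rewrite ?pickleK// mem_iota.
Qed.

Lemma wdist_restr_cvg eta : finite_norm a eta ->
  wdist a (restr n eta) eta @[n --> \oo] --> 0%E.
Proof.
move=> fin; pose u n x := `|(restr n eta x)%:R - (eta x)%:R| * a x.
have u_le n x : 0 <= u n x <= (eta x)%:R * a x.
  rewrite mulr_ge0//= ler_wpM2r// /restr; case: ifP => _; rewrite ?subrr ?normr0//.
  by rewrite sub0r normrN ger0_norm.
have u0 n x : 0 <= u n x by case/andP: (u_le n x).
have uoo n : (\esum_(x in setT) (u n x)%:E < +oo)%E.
  apply: le_lt_trans fin; apply: le_esum => x _; rewrite lee_fin.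
  by case/andP: (u_le n x).
rewrite (_ : (fun n => _) = fun n => (rsum setT (u n))%:E); last first.
  by apply/funext => n; rewrite rsum_ge0E.
have rsum0 : rsum [set: lattice d] (fun=> 0 : R) = 0.
  by apply: EFin_inj; rewrite rsum_ge0E ?esum1.
rewrite -[0%E]/((0 : R)%:E) -rsum0.
apply: cvg_EFin; first exact: nearW.
apply: (rsum_cvg (b := fun x => (eta x)%:R * a x)) => //.
- move=> x _; apply: cvg_near_cst; near=> n.
  rewrite /u /restr ifT ?subrr ?normr0 ?mul0r//.
  by near: n; exists (pickle x).+1.
- by move=> n x _; rewrite ger0_norm//; case/andP: (u_le n x).
- by move=> x; rewrite mulr_ge0.
Unshelve. all: by end_near. Qed.

Section lipschitz.
Variables (h : conf d -> R) (L : R).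
Hypothesis hL : lipschitz_with a L h.

Lemma lipschitz_restr_cvg eta : finite_norm a eta ->
  h (restr n eta) @[n --> \oo] --> h eta.
Proof.
move=> fin; have [L0 hl] := hL; apply/cvgrPdist_le => e e0.
have eL : (0 < (e / L)%:E)%E by rewrite lte_fin divr_gt0.
have [fin_dist] := (fine_cvgP _ _).1 (wdist_restr_cvg fin).
move=> /cvgr0_norm_le /(_ (e / L)); rewrite divr_gt0// => /(_ isT) small.
near=> n.
have dist_fin : wdist a (restr n eta) eta \is a fin_num by near: n.
rewrite distrC -lee_fin; apply: le_trans (hl _ _ (finite_norm_restr n fin) fin) _.
rewrite -(fineK dist_fin) -EFinM lee_fin mulrC -ler_pdivlMr//.
apply: le_trans (ler_norm _) _; near: n; exact: small.
Unshelve. all: by end_near. Qed.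

Lemma lipschitz_restr n : lipschitz_with a L (h \o restr n).
Proof.
have [L0 hl] := hL; split=> // eta zeta fe fz.
apply: le_trans (hl _ _ (finite_norm_restr n fe) (finite_norm_restr n fz)) _.
by apply: lee_wpmul2l; [rewrite lee_fin ltW|exact: wdist_restr].
Qed.

(** A Lipschitz function is the pointwise limit of its restrictions to boxes,
    which are cylinder functions. *)
Lemma lipschitz_measurable : measurable (finite_norm a) -> measurable_fun (finite_norm a) h.
Proof.
move=> mE; apply: (measurable_fun_cvg (h := fun n => h \o restr n)) => [n|eta].
  apply: measurable_funS (measurable_cylinder (cylinder_restr h n)) => //.
exact: lipschitz_restr_cvg.
Qed.

Lemma lipschitz_jump k x y eta : finite_norm a eta ->
  `|h (jump k x y eta) - h eta| <= L * (k%:R * (a x + a y)).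
Proof.
move=> fin; have [L0 hl] := hL; rewrite -lee_fin.
apply: le_trans (hl _ _ (finite_norm_jump _ _ _ fin) fin) _.
by rewrite EFinM; apply: lee_wpmul2l; [rewrite lee_fin ltW|exact: wdist_jump].
Qed.

End lipschitz.

Lemma measurable_wnorm : measurable_fun setT (wnorm a).
Proof.
apply: measurable_esum => [x eta|x]; first by rewrite lee_fin mulr_ge0.
by apply/measurable_EFinP; exact: (measurable_coord_fun (fun n => n%:R * a x)).
Qed.

Lemma measurable_finite_norm : measurable (finite_norm a).
Proof.
pose Y : set (\bar R) := [set` Interval -oo%O (BLeft +oo%E)].
rewrite (_ : finite_norm a = setT `&` wnorm a @^-1` Y).
  by apply: measurable_wnorm => //; exact: emeasurable_itv.
by rewrite setTI; apply/seteqP; split=> eta; rewrite /Y /= in_itv.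
Qed.

(** If f distinguishes two configurations, they differ on s, hence are at
    distance at least the minimum of the weight on s. *)
Lemma cylinder_lip (f : conf d -> R) : bounded_on setT f -> cylinder f -> lip a f.
Proof.
move=> [B fB] [s fs].
have [m m0 ma] : exists2 m, 0 < m & forall x, x \in s -> m <= a x.
  elim: s {fs} => [|x s [m m0 ma]]; first by exists 1.
  exists (Num.min (a x) m); first by rewrite lt_min a_gt0.
  move=> y; rewrite inE => /predU1P[->|/ma my]; first by rewrite ge_min lexx.
  by rewrite ge_min my orbT.
have B0 : 0 <= B by apply: le_trans (fB (fun=> 0%N) I).
exists ((B + B) / m + 1); split; first by rewrite ltr_wpDl// divr_ge0 ?addr_ge0// ltW.
move=> eta zeta _ _.
have [agree|] := pselect (forall x, x \in s -> eta x = zeta x).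
  by rewrite (fs _ _ agree) subrr normr0 mule_ge0 ?wdist_ge0// lee_fin addr_ge0// divr_ge0 ?addr_ge0// ltW.
move=> /existsNP[x /not_implyP[xs /eqP neq]].
have md : (m%:E <= wdist a eta zeta)%E.
  apply: le_trans (esum_term_le x (c := fun x => (`|(eta x)%:R - (zeta x)%:R| * a x)%:E) _); last first.
    by move=> u; rewrite lee_fin mulr_ge0.
  rewrite lee_fin (le_trans (ma x xs))// ler_peMl//.
  have [lt|lt|e] := ltngtP (eta x) (zeta x); last by rewrite e eqxx in neq.
  - by rewrite distrC -natrB 1?ltnW// normr_nat ler1n subn_gt0.
  - by rewrite -natrB 1?ltnW// normr_nat ler1n subn_gt0.
apply: (@le_trans _ _ (((B + B) / m + 1)%:E * m%:E)%E); last first.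
  by apply: lee_wpmul2l => //; rewrite lee_fin addr_ge0// divr_ge0 ?addr_ge0// ltW.
rewrite -EFinM lee_fin mulrDl mul1r divfK ?gt_eqF//.
apply: le_trans (ler_normB _ _) _.
by have := fB eta I; have := fB zeta I; lra.
Qed.

End weighted_norm.

(** * The generator on Lipschitz functions *)

Section generator_bound.
Context (R : realType) (d : nat) (a : lattice d -> R) (M C : R).
Variable p : lattice d -> lattice d -> R.
Hypothesis p_ge0 : forall x y, 0 <= p x y.
Hypothesis p_row : forall x, \esum_(y in setT) (p x y)%:E = 1%E.
Hypothesis a_weight : admissible_weight p a M.
Variable g : nat -> nat -> R.
Hypothesis g_ge0 : forall k n, 0 <= g k n.
Hypothesis g_small : forall k n, (n < k)%N -> g k n = 0.
Hypothesis C_gt0 : 0 < C.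
Hypothesis g_growth : forall n, \sum_(k < n.+1) k%:R * g k n <= C * n%:R.
Implicit Types (x y : lattice d) (eta zeta : conf d).

Let a_gt0 x : 0 < a x. Proof. by case: a_weight. Qed.
Let a_ge0 x : 0 <= a x. Proof. exact: ltW. Qed.
Let M_ge0 : 0 <= M. Proof. by case: a_weight => /ltW. Qed.

Definition jump_bound (L : R) eta (i : lattice d * lattice d * nat) : R :=
  let: (x, y, k) := i in p x y * (g k (eta x) * (L * (k%:R * (a x + a y)))).

Lemma jump_bound_ge0 L eta i : 0 <= L -> 0 <= jump_bound L eta i.
Proof. by move=> L0; case: i => -[x y] k; rewrite /jump_bound !mulr_ge0// addr_ge0. Qed.

Lemma esum_rate_le n : (\esum_(k in setT) (k%:R * g k n)%:E <= (C * n%:R)%:E)%E.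
Proof.
rewrite (_ : (fun k => _) = fun k => if (k <= n)%N then (k%:R * g k n)%:E else 0%E).
  rewrite (esum_initial (a := fun k => (k%:R * g k n)%:E)) ?sumEFin ?lee_fin//.
  by move=> k; rewrite lee_fin mulr_ge0.
by apply/funext => k; case: ifPn => //; rewrite -ltnNge => nk; rewrite g_small// mulr0.
Qed.

Lemma esum_neighbour_le x : (\esum_(y in setT) (p x y * (a x + a y))%:E <= ((1 + M) * a x)%:E)%E.
Proof.
under eq_esum do rewrite mulrDr EFinD.
rewrite esumD; try by move=> y _; rewrite lee_fin mulr_ge0.
rewrite mulrDl mul1r EFinD; apply: leeD.
  under eq_esum do rewrite EFinM.
  by rewrite ge0_esumZr//; [rewrite p_row mul1e|move=> y; rewrite lee_fin].
case: a_weight => _ _ /(_ x) + _; apply: le_trans.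
by rewrite leeDl// esum_ge0// => y _; rewrite lee_fin mulr_ge0.
Qed.

(** Linear growth controls the sum over k, and the weight inequality the sum
    over the arrival site y. *)
Lemma esum_jump_bound L eta : 0 <= L ->
  (\esum_(i in [set i : lattice d * lattice d * nat | (0 < i.2)%N]) (jump_bound L eta i)%:E
   <= (L * C * (1 + M))%:E * wnorm a eta)%E.
Proof.
move=> L0; have jb0 i : (0 <= (jump_bound L eta i)%:E)%E by rewrite lee_fin jump_bound_ge0.
apply: (@le_trans _ _ (\esum_(i in setT) (jump_bound L eta i)%:E)%E).
  by rewrite esum_mkcond; apply: le_esum => i _; case: ifP.
have LCM : 0 <= L * C * (1 + M) by rewrite !mulr_ge0 ?addr_ge0// ltW.
rewrite esum_pair// esum_pair; last by move=> xy; apply: esum_ge0.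
rewrite -ge0_esumZl//; last by move=> x; rewrite lee_fin mulr_ge0.
apply: le_esum => x _.
apply: (@le_trans _ _ (\esum_(y in setT) ((p x y * (a x + a y))%:E * (L * C * (eta x)%:R)%:E))%E).
  apply: le_esum => y _.
  have pa0 : 0 <= p x y * (a x + a y) by rewrite mulr_ge0 ?addr_ge0.
  apply: (@le_trans _ _ ((p x y * (a x + a y) * L)%:E *
                          \esum_(k in setT) (k%:R * g k (eta x))%:E)%E).
    rewrite -ge0_esumZl ?mulr_ge0 ?addr_ge0//; last by move=> k; rewrite lee_fin mulr_ge0.
    apply: le_esum => k _; rewrite -EFinM lee_fin /jump_bound.
    by rewrite le_eqVlt; apply/orP; left; apply/eqP; ring.
  rewrite EFinM -muleA.
  apply: lee_wpmul2l; first by rewrite lee_fin.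
  rewrite -mulrA EFinM; apply: lee_wpmul2l; first by rewrite lee_fin.
  exact: esum_rate_le.
rewrite ge0_esumZr//; last 2 first.
- by rewrite !mulr_ge0// ltW.
- by move=> y; rewrite lee_fin mulr_ge0 ?addr_ge0.
apply: (@le_trans _ _ (((1 + M) * a x)%:E * (L * C * (eta x)%:R)%:E)%E).
  by apply: lee_wpmul2r; [rewrite lee_fin !mulr_ge0// ltW|exact: esum_neighbour_le].
by rewrite -!EFinM lee_fin le_eqVlt; apply/orP; left; apply/eqP; ring.
Qed.

Section lipschitz_function.
Variables (h : conf d -> R) (L : R).
Hypothesis hL : lipschitz_with a L h.
Let L_ge0 : 0 <= L. Proof. by case: hL => /ltW. Qed.

Lemma jump_term_le eta x y k : finite_norm a eta ->
  `|p x y * g k (eta x) * (h (jump k x y eta) - h eta)| <= jump_bound L eta (x, y, k).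
Proof.
move=> fin; rewrite /jump_bound -mulrA normrM ger0_norm//; apply: ler_wpM2l => //.
rewrite normrM ger0_norm//; apply: ler_wpM2l => //.
exact: (lipschitz_jump a_gt0 hL _ _ _ fin).
Qed.

Lemma generator_le eta : finite_norm a eta ->
  (`|generator p (zrp_rates g) h eta|%:E <= (L * C * (1 + M))%:E * wnorm a eta)%E.
Proof.
move=> fin; apply: le_trans (esum_jump_bound eta L_ge0).
apply: abs_rsum_le; last by move=> i; exact: jump_bound_ge0.
by move=> -[[x y] k] _; exact: jump_term_le.
Qed.
End lipschitz_function.

(** All the restrictions share the Lipschitz constant of h, hence the
    dominating family [jump_bound]. *)
Lemma generator_restr_cvg (h : conf d -> R) L eta : lipschitz_with a L h ->
  finite_norm a eta ->
  generator p (zrp_rates g) (h \o restr n) eta @[n --> \oo]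
    --> generator p (zrp_rates g) h eta.
Proof.
move=> hL fin; have L0 : 0 <= L by case: hL => /ltW.
apply: (rsum_cvg (b := jump_bound L eta)).
- move=> -[[x y] k] _; apply: cvgMl_tmp; apply: cvgB.
    by apply: (lipschitz_restr_cvg a_gt0 hL); exact: finite_norm_jump.
  exact: (lipschitz_restr_cvg a_gt0 hL).
- move=> n [[x y] k] _; exact: (jump_term_le (lipschitz_restr a_gt0 hL n)).
- by move=> i; exact: jump_bound_ge0.
- apply: le_lt_trans (esum_jump_bound eta L0) _.
  by rewrite lte_mul_pinfty// lee_fin !mulr_ge0 ?addr_ge0// ltW.
Qed.

End generator_bound.

Section norm_moment.
Context (R : realType) (d : nat) (a : lattice d -> R).
Context (nu : probability (conf d) R) (mu : nat -> R).
Hypothesis nu_product : product_measure_on_sites nu.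
Hypothesis nu_marginal : single_site_marginal nu mu.
Hypothesis a_gt0 : forall x, 0 < a x.
Hypothesis a_summable : (\esum_(x in setT) (a x)%:E < +oo)%E.
Hypothesis mu_moment : finite_first_moment mu.

Lemma integral_wnorm : (\int[nu]_eta wnorm a eta < +oo)%E.
Proof.
have a0 x : 0 <= a x by exact: ltW.
have mu0 := marginal_ge0 nu_marginal.
pose m1 : \bar R := \esum_(n in setT) (n%:R * mu n)%:E.
have nmu0 n : (0 <= (n%:R * mu n)%:E)%E by rewrite lee_fin mulr_ge0.
have m1oo : (m1 < +oo)%E by rewrite /m1 -nneseries_esumT.
have m10 : (0 <= m1)%E by exact: esum_ge0.
have m1fin : m1 \is a fin_num by rewrite ge0_fin_numE.
have coord x : (\int[nu]_eta ((eta x)%:R : R)%:E = m1)%E.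
  rewrite (resample nu_product nu_marginal x)//; last first.
    by apply/measurable_EFinP; exact: (measurable_coord_fun (fun n => n%:R : R)).
  apply: eq_esum => n _; under eq_integral do rewrite upd_same.
  by rewrite integral_cst//= probability_setT mule1 mulrC EFinM.
rewrite integral_esum//; last 2 first.
- by move=> x eta; rewrite lee_fin mulr_ge0.
- by move=> x; apply/measurable_EFinP; exact: (measurable_coord_fun (fun n => n%:R * a x)).
under eq_esum => x _.
  under eq_integral do rewrite EFinM muleC.
  rewrite ge0_integralZl//; last 2 first.
  - by apply/measurable_EFinP; exact: (measurable_coord_fun (fun n => n%:R : R)).
  - by rewrite lee_fin.
  rewrite coord -(fineK m1fin).
  over.
rewrite ge0_esumZr//; last by rewrite fine_ge0.
rewrite lte_mul_pinfty ?ltry ?esum_ge0 ?esum_fin_num//.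
all: by move=> *; rewrite lee_fin.
Qed.

Lemma integrable_wnorm : nu.-integrable setT (wnorm a).
Proof.
apply: ge0_integrable_lty; [exact: measurable_wnorm|exact: wnorm_ge0|exact: integral_wnorm].
Qed.

Lemma finite_norm_full : nu (finite_norm a) = 1%E.
Proof.
have mE := measurable_finite_norm a_gt0.
have : nu (~` finite_norm a) = 0%E.
  have := integrable_ae measurableT integrable_wnorm.
  move=> [N [mN N0 sub]]; apply: subset_measure0 N0 => //; first exact: measurableC.
  move=> eta nE; apply: sub => /= /(_ I) fin; apply: nE.
  by rewrite /Defs.finite_norm /= ltey_eq fin.
rewrite probability_setC// => /eqP; rewrite sube_eq ?fin_num_measure//.
  by rewrite add0e eq_sym => /eqP.
Qed.

End norm_moment.

(** * Invariance for a semigroup on Lipschitz functions *)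

Lemma expRB1_le (R : realType) (x : R) : expR x - 1 <= x * expR x.
Proof.
have := expR_ge1Dx (- x); rewrite expRN => h.
have e0 := expR_gt0 x.
have : (1 - x) * expR x <= 1.
  by rewrite -(@ler_pM2r _ (expR x)^-1) ?invr_gt0// mulfK ?gt_eqF// mul1r.
lra.
Qed.

Section lipschitz_semigroup.
Context (R : realType) (d : nat) (a : lattice d -> R) (M C : R).
Variable p : lattice d -> lattice d -> R.
Hypothesis p_ge0 : forall x y, 0 <= p x y.
Hypothesis p_row : forall x, \esum_(y in setT) (p x y)%:E = 1%E.
Hypothesis a_weight : admissible_weight p a M.
Variable g : nat -> nat -> R.
Hypothesis g_ge0 : forall k n, 0 <= g k n.
Hypothesis g_small : forall k n, (n < k)%N -> g k n = 0.
Hypothesis C_gt0 : 0 < C.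
Hypothesis g_growth : forall n, \sum_(k < n.+1) k%:R * g k n <= C * n%:R.
Variables (nu : probability (conf d) R) (mu : nat -> R).
Hypothesis nu_product : product_measure_on_sites nu.
Hypothesis nu_marginal : single_site_marginal nu mu.
Hypothesis mu_moment : finite_first_moment mu.
Variable S : R -> (conf d -> R) -> conf d -> R.
Hypothesis S_mmp : mmp_semigroup p (zrp_rates g) a S.
Local Notation E := (finite_norm a).
Implicit Types (x y : lattice d) (eta zeta : conf d) (f h : conf d -> R).

Let a_gt0 x : 0 < a x. Proof. by case: a_weight. Qed.
Let a_ge0 x : 0 <= a x. Proof. exact: ltW. Qed.
Let M_ge0 : 0 <= M. Proof. by case: a_weight => /ltW. Qed.
Let mE : measurable E := measurable_finite_norm a_gt0.
Let nuE : nu E = 1%E.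
Proof. by apply: (finite_norm_full nu_product nu_marginal); case: a_weight. Qed.
Let S_markov := mmp_markov S_mmp.

Let lip_measurable f : lip a f -> measurable_fun E f.
Proof. by move=> [L fL]; exact: lipschitz_measurable fL mE. Qed.

Lemma integrable_scaled_wnorm (K : R) : nu.-integrable E (fun eta => K%:E * wnorm a eta)%E.
Proof.
apply: integrableZl => //; apply: (integrableS measurableT) => //.
by apply: (integrable_wnorm nu_product nu_marginal); case: a_weight.
Qed.

Lemma lip_const (b : R) : lip a (fun=> b).
Proof.
exists 1; split=> // eta zeta _ _; rewrite subrr normr0 mule_ge0 ?lee_fin//.
exact: wdist_ge0.
Qed.

(** A semigroup given by its action on a class of functions need not fix
    constants a priori: linearity and the value at 1 give it. *)
Lemma semigroup_const (B : R) t eta : 0 <= t -> E eta -> S t (fun=> B) eta = B.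
Proof.
move=> t0 fin.
have S0 : S t (fun=> 0) eta = 0.
  have := markov_linear S_markov 1 t0 (lip_const 0) (lip_const 0) fin.
  have -> : (fun _ : conf d => 1 * 0 + 0 : R) = fun=> 0.
    by apply/funext => zeta; rewrite mulr0 addr0.
  lra.
have := markov_linear S_markov B t0 (lip_const 1) (lip_const 0) fin.
rewrite (markov_unit S_markov)// S0 mulr1 addr0 => h.
by rewrite -[RHS]h; congr (S t _ eta); apply/funext => zeta; rewrite mulr1 addr0.
Qed.

Lemma semigroup_bounded f (B : R) t eta : lip a f -> (forall zeta, E zeta -> `|f zeta| <= B) ->
  0 <= t -> E eta -> `|S t f eta| <= B.
Proof.
move=> lf fB t0 fin.
have lipL (c : R) : `|c| = 1 -> lip a (fun zeta => c * f zeta + B).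
  move=> c1; case: lf => L [L0 fL]; exists L; split=> // eta' zeta' fe fz.
  by rewrite opprD addrACA subrr addr0 -mulrBr normrM c1 mul1r; exact: fL.
have half (c : R) : `|c| = 1 -> 0 <= c * S t f eta + B.
  move=> c1; rewrite -(semigroup_const B t0 fin) -(markov_linear S_markov c t0 lf (lip_const B) fin).
  apply: (markov_ge0 S_markov) => // [|zeta fz]; first exact: lipL.
  have : `|c * f zeta| <= B by rewrite normrM c1 mul1r fB.
  by rewrite ler_norml => /andP[+ _]; lra.
have := half 1 (normr1 _); have := half (-1) _; rewrite normrN1 => /(_ erefl).
by rewrite ler_norml => ? ?; apply/andP; split; lra.
Qed.

Lemma bounded_integrable f (B : R) : measurable_fun E f ->
  (forall eta, E eta -> `|f eta| <= B) -> nu.-integrable E (EFin \o f).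
Proof.
move=> mf fB; apply: (@le_integrable _ _ _ _ _ _ _ (cst B%:E)) => //.
- exact/measurable_EFinP.
- by move=> eta fin; rewrite /= lee_fin (le_trans (fB _ fin))// ler_norm.
by apply: finite_measure_integrable_cst.
Qed.

(** Dominated convergence: by [expRB1_le] the growth bound on S u F - F is
    linear in u, uniformly on bounded intervals. *)
Lemma semigroup_derivative_integral (F : conf d -> R) (u : nat -> R) :
  lip a F -> (forall n, 0 < u n) -> u @ \oo --> 0 ->
  (\int[nu]_(eta in E) ((S (u n) F eta - F eta) / u n)%:E)%E @[n --> \oo] -->
  (\int[nu]_(eta in E) (generator p (zrp_rates g) F eta)%:E)%E.
Proof.
move=> lF u0 u_cvg; have [L FL] := lF; have [L0 _] := FL.
have [c c0 Sbound] := mmp_bound S_mmp.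
have [U uU] : exists U : R, forall n, u n <= U.
  have /cvg_seq_bounded[U [_ uU]] : cvgn u by apply/cvg_ex; exists 0.
  exists (U + 1) => n; apply: le_trans (ler_norm _) _.
  by apply: uU => //; rewrite ltrDl.
pose K := L * (c * expR (c * U)).
have mquot n : measurable_fun E (fun eta => (S (u n) F eta - F eta) / u n).
  apply: measurable_funM => //; apply: measurable_funB; apply: lip_measurable => //.
  by apply: (markov_stable S_markov) => //; exact: ltW.
have quot_cvg eta : E eta -> (S (u n) F eta - F eta) / u n @[n --> \oo] -->
    generator p (zrp_rates g) F eta.
  move=> fin; have /cvg_at_rightP := mmp_derivative S_mmp lF fin.
  by apply; split.
have mgen : measurable_fun E (generator p (zrp_rates g) F).
  exact: measurable_fun_cvg mquot quot_cvg.
have dom : forall eta n, E eta ->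
    (`|((S (u n) F eta - F eta) / u n)%:E| <= K%:E * wnorm a eta)%E.
  move=> eta n fin; rewrite /= normrM normfV (gtr0_norm (u0 n)) EFinM.
  apply: (@le_trans _ _ ((wnorm a eta * (L * (expR (c * u n) - 1))%:E) * (u n)^-1%:E)%E).
    apply: lee_wpmul2r; first by rewrite lee_fin invr_ge0 ltW.
    by apply: Sbound => //; exact: ltW.
  rewrite -muleA muleC -EFinM; apply: lee_wpmul2r; first exact: wnorm_ge0.
  rewrite lee_fin /K -mulrA; apply: ler_wpM2l; first exact: ltW.
  rewrite ler_pdivrMr//; apply: le_trans (expRB1_le _) _.
  rewrite mulrAC; apply: ler_wpM2r; first exact: ltW.
  apply: ler_wpM2l; first exact: ltW.
  by rewrite ler_expR; apply: ler_wpM2l; [exact: ltW|exact: uU].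
have mEquot n : measurable_fun E (fun eta => ((S (u n) F eta - F eta) / u n)%:E).
  exact/measurable_EFinP.
have mEgen : measurable_fun E (fun eta => (generator p (zrp_rates g) F eta)%:E).
  exact/measurable_EFinP.
have ae_cvg : {ae nu, forall eta, E eta ->
    (fun n => ((S (u n) F eta - F eta) / u n)%:E) @ \oo -->
    (generator p (zrp_rates g) F eta)%:E}.
  by apply: aeW => eta fin; apply: cvg_EFin; [exact: nearW|exact: quot_cvg].
by have [] := dominated_convergence mE mEquot mEgen ae_cvg
  (integrable_scaled_wnorm K) (aeW _ dom).
Qed.

Lemma measurable_generator f : measurable_fun setT f ->
  measurable_fun setT (generator p (zrp_rates g) f).
Proof.
move=> mf; apply: measurable_rsum => // -[[x y] k].
apply: measurable_funM; last first.
  by apply: measurable_funB => //; apply: (measurableT_comp mf); exact: measurable_jump.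
by apply: measurable_funM => //; exact: measurable_coord_fun.
Qed.

Lemma integral_finite_norm (F : conf d -> R) : measurable_fun setT F ->
  (\int[nu]_(eta in E) (F eta)%:E = \int[nu]_eta (F eta)%:E)%E.
Proof.
move=> mF; have mEF : measurable_fun setT (EFin \o F) by exact/measurable_EFinP.
rewrite integral_mkcond; apply: ae_eq_integral => //.
  by apply/measurable_restrict => //; exact: measurable_funS mEF.
have nuE0 : nu (~` E) = 0%E.
  by rewrite probability_setC// nuE subee.
exists (~` E); split=> //; first exact: measurableC.
move=> eta /= neq fin; apply: neq => _.
by rewrite /patch mem_set.
Qed.

Lemma restr_finite_norm n eta : E (restr n eta).
Proof.
pose s : seq (lattice d) := pmap unpickle (iota 0 n).
pose K := \max_(x <- s) eta x.
have leK x : (restr n eta x <= K)%N.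
  rewrite /restr; case: ifPn => // xn; apply: (@leq_bigmax_seq _ s xpredT) => //.
  by rewrite mem_pmap; apply/mapP; exists (pickle x); rewrite ?pickleK// mem_iota.
apply: (@le_lt_trans _ _ (\esum_(x in setT) (K%:R%:E * (a x)%:E))%E).
  by apply: le_esum => x _; rewrite -EFinM lee_fin ler_wpM2r// ler_nat.
rewrite ge0_esumZl//.
by rewrite lte_mul_pinfty ?lee_fin//; case: a_weight.
Qed.

Section generator_null.
Hypothesis generator0 : forall f : conf d -> R, bounded_on setT f -> cylinder f ->
  (\int[nu]_eta (generator p (zrp_rates g) f eta)%:E = 0)%E.

(** Passing to the limit along the restrictions of h to boxes, which are
    bounded cylinder functions. *)
Lemma generator_integral0 (h : conf d -> R) : lip a h -> bounded_on E h ->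
  (\int[nu]_(eta in E) (generator p (zrp_rates g) h eta)%:E = 0)%E.
Proof.
move=> [L hL] [B hB].
pose G n := generator p (zrp_rates g) (h \o restr n).
have mG n : measurable_fun setT (G n).
  by apply: measurable_generator; apply: measurable_cylinder; exact: cylinder_restr.
have Gcvg eta : E eta -> G n eta @[n --> \oo] --> generator p (zrp_rates g) h eta.
  exact: (generator_restr_cvg p_ge0 p_row a_weight g_ge0 g_small C_gt0 g_growth hL).
have mEG n : measurable_fun E (fun eta => (G n eta)%:E).
  by apply/measurable_EFinP; exact: measurable_funS (mG n).
have mEgen : measurable_fun E (fun eta => (generator p (zrp_rates g) h eta)%:E).
  apply/measurable_EFinP; apply: (measurable_fun_cvg (h := G)) => // n.
  exact: measurable_funS (mG n).
have ae_cvg : {ae nu, forall eta, E eta ->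
    (fun n => (G n eta)%:E) @ \oo --> (generator p (zrp_rates g) h eta)%:E}.
  by apply: aeW => eta fin; apply: cvg_EFin; [exact: nearW|exact: Gcvg].
have dom : {ae nu, forall eta n, E eta ->
    (`|(G n eta)%:E| <= (L * C * (1 + M))%:E * wnorm a eta)%E}.
  apply: aeW => eta n fin.
  exact: (generator_le p_ge0 p_row a_weight g_ge0 g_small C_gt0 g_growth
           (lipschitz_restr a_gt0 hL n) fin).
have [_ _] := dominated_convergence mE mEG mEgen ae_cvg (integrable_scaled_wnorm _) dom.
rewrite (_ : (fun n => _) = fun=> 0%E); last first.
  apply/funext => n; rewrite integral_finite_norm// generator0//; last exact: cylinder_restr.
  by exists B => eta _; apply: hB; exact: restr_finite_norm.
by move=> /cvg_lim <-//; rewrite lim_cst.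
Qed.

End generator_null.

(** Forwards, the integrals of the difference quotients at time 0 vanish.
    Backwards, the semigroup property moves the difference quotient at time r
    to one at time 0 for S r f, whose generator has integral zero. *)
Theorem lipschitz_invariance : invariant_measure E a S nu <->
  (forall f : conf d -> R, bounded_on setT f -> cylinder f ->
     \int[nu]_eta (generator p (zrp_rates g) f eta)%:E = 0)%E.
Proof.
split=> [[_ inv] f [B fB] cf|generator0].
  have lf : lip a f by apply: (cylinder_lip a_gt0) => //; exists B.
  have fBE eta : E eta -> `|f eta| <= B by move=> _; exact: fB.
  have bf : bounded_on E f by exists B.
  have mgen : measurable_fun setT (generator p (zrp_rates g) f).
    by apply: measurable_generator; exact: measurable_cylinder.
  rewrite -(integral_finite_norm mgen).
  pose u n : R := n.+1%:R^-1.
  have u0 n : 0 < u n by rewrite invr_gt0.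
  have := semigroup_derivative_integral lf u0 (@cvg_harmonic R).
  rewrite (_ : (fun n => \int[nu]_(eta in E) ((S (u n) f eta - f eta) / u n)%:E)%E =
    fun=> 0%E); first by move=> /cvg_lim <-//; rewrite lim_cst.
  apply/funext => n; have un0 : 0 <= u n by exact: ltW.
  have lSf : lip a (S (u n) f) by exact: (markov_stable S_markov).
  have iSf := bounded_integrable (lip_measurable lSf)
    (fun eta => semigroup_bounded lf fBE un0 (eta := eta)).
  have i_f := bounded_integrable (lip_measurable lf) fBE.
  under eq_integral do rewrite EFinM.
  rewrite integralZr//; last exact: (integrableB mE iSf i_f).
  under eq_integral do rewrite EFinB.
  rewrite integralB//= inv// ?subee ?mul0e//; last exact: lip_measurable.
  exact: integrable_fin_num.
split=> // f t lf [B fB] mf t0.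
pose phi t := Rintegral nu E (fun eta => S t f eta).
have lS r : 0 <= r -> lip a (S r f) by move=> r0; exact: (markov_stable S_markov).
have Sb r : 0 <= r -> forall eta, E eta -> `|S r f eta| <= B.
  by move=> r0 eta; exact: (semigroup_bounded lf fB r0).
have iS r : 0 <= r -> nu.-integrable E (EFin \o S r f).
  by move=> r0; exact: bounded_integrable (lip_measurable (lS r r0)) (Sb r r0).
have phiE r : 0 <= r -> ((phi r)%:E = \int[nu]_(eta in E) (S r f eta)%:E)%E.
  move=> r0; rewrite /phi /Rintegral fineK//.
  exact: (integrable_fin_num mE (iS r r0)).
have phi_cont r : 0 < r -> {for r, continuous phi}.
  move=> r0; have r_in : r \in `]0, (r + 1)[%classic.
    by rewrite inE /= in_itv /= r0 ltrDl ltr01.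
  apply: (continuity_under_integral (B := E) (f := fun t eta => S t f eta)
    (u := 0) (v := r + 1) (g := cst B) mE _ _ _ _ r_in).
  - by move=> x; rewrite /= in_itv /= => /andP[x0 _]; apply: iS; exact: ltW.
  - apply: aeW => eta fin x; rewrite inE /= in_itv /= => /andP[x0 _].
    have := mmp_continuous S_mmp lf fin.
    rewrite continuous_within_itvcyP => -[+ _]; apply.
    by rewrite in_itv /= x0.
  - exact: finite_measure_integrable_cst.
  - move=> x; rewrite /= in_itv /= => /andP[x0 _].
    by apply: aeW => eta fin; apply: Sb => //; exact: ltW.
have phi_deriv r : 0 <= r -> (phi (r + u) - phi r) / u @[u --> 0^'+] --> 0.
  move=> r0; apply/cvg_at_rightP => u [u0 u_cvg].
  have bS : bounded_on E (S r f) by exists B; exact: Sb.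
  have := semigroup_derivative_integral (lS r r0) u0 u_cvg.
  rewrite generator_integral0//; last exact: lS.
  rewrite (_ : (fun n => \int[nu]_(eta in E)
      ((S (u n) (S r f) eta - S r f eta) / u n)%:E)%E =
    fun n => ((phi (r + u n) - phi r) / u n)%:E).
    by move/fine_cvg.
  apply/funext => n; have un0 : 0 <= u n by exact: ltW.
  have run0 : 0 <= r + u n by exact: addr_ge0.
  rewrite EFinM EFinB !phiE// -integralB//; try exact: iS.
  rewrite -integralZr//; last exact: (integrableB mE (iS _ run0) (iS _ r0)).
  apply: eq_integral => eta /set_mem fin.
  by rewrite [r + u n]addrC (markov_add S_markov).
rewrite -(phiE t t0) (constant_of_right_derivative phi_cont phi_deriv t0) phiE//.
apply: eq_integral => eta /set_mem fin.
by rewrite (markov_id S_markov).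
Qed.

End lipschitz_semigroup.

(** * Finite total flow, double stochasticity, and the symmetric example *)

Section total_flow.
Context (R : realType) (mu : nat -> R) (g : nat -> nat -> R).
Hypothesis mu_ge0 : forall n, 0 <= mu n.
Hypothesis g_ge0 : forall k n, 0 <= g k n.
Local Open Scope ereal_scope.

(** Regrouping the jumps by the occupation before the jump: the total flow is
    the mean total jump rate. *)
Lemma total_flowE : \esum_(i in [set: nat * nat]) (flow mu g i.1 i.2)%:E =
  \esum_(n in setT) (mu n * \sum_(k < n.+1) g k n)%:E.
Proof.
have term0 k n : 0 <= (g k n * mu n)%:E by rewrite lee_fin mulr_ge0.
rewrite esum_pair; last by move=> i; exact: term0.
under eq_esum => k _ do rewrite (esum_shift (fun n => (g k n * mu n)%:E)).
rewrite esum_exchange; last by move=> k n; case: ifP.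
apply: eq_esum => n _; rewrite (esum_initial n (a := fun k => (g k n * mu n)%:E))//.
by rewrite sumEFin mulr_sumr; congr (_%:E); apply: eq_bigr => k _; rewrite mulrC.
Qed.

Lemma linear_flow_finite C : (0 < C)%R ->
  (forall n, \sum_(k < n.+1) k%:R * g k n <= C * n%:R)%R ->
  (forall n, g 0%N n = 0%R) ->
  finite_first_moment mu ->
  \esum_(i in [set: nat * nat]) (flow mu g i.1 i.2)%:E < +oo.
Proof.
move=> C0 growth g0 moment; rewrite total_flowE.
apply: (@le_lt_trans _ _ (\esum_(n in setT) (C%:E * (n%:R * mu n)%:E))).
  apply: le_esum => n _; rewrite -EFinM lee_fin mulrC mulrA; apply: ler_wpM2r => //.
  apply: le_trans (growth n); apply: ler_sum => -[[|k] kn] _ /=; first by rewrite g0 mulr0.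
  by rewrite ler_peMl// ler1n.
rewrite ge0_esumZl//; [|exact: ltW|by move=> n; rewrite lee_fin mulr_ge0].
rewrite lte_mul_pinfty ?lee_fin ?(ltW C0)//.
by rewrite -nneseries_esumT// => n; rewrite lee_fin mulr_ge0.
Qed.

Lemma bounded_flow_finite C : (0 < C)%R ->
  (forall n, \sum_(k < n.+1) g k n <= C)%R ->
  \esum_(n in setT) (mu n)%:E = 1 ->
  \esum_(i in [set: nat * nat]) (flow mu g i.1 i.2)%:E < +oo.
Proof.
move=> C0 bound mu1; rewrite total_flowE.
apply: (@le_lt_trans _ _ (\esum_(n in setT) ((mu n)%:E * C%:E))).
  by apply: le_esum => n _; rewrite -EFinM lee_fin; apply: ler_wpM2l.
by rewrite ge0_esumZr ?mu1 ?mul1e ?ltry ?(ltW C0)// => n; rewrite lee_fin.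
Qed.

End total_flow.

(** The reflection x |-> 2y - x exchanges rows and columns of a
    translation-invariant kernel. *)
Lemma doubly_stochastic (R : realType) (d : nat) (p : lattice d -> lattice d -> R) :
  transition_probability p -> translation_invariant_kernel p ->
  forall y, \esum_(x in setT) (p x y)%:E = 1%E.
Proof.
move=> [_ row] inv y; rewrite -(row y) [RHS](reindex_esum setT setT (fun x => y + y - x)).
  apply: eq_esum => x _; rewrite -(inv x y (y - x)) addrC subrK.
  by rewrite addrA.
split=> // [x x' _ _ /addrI/oppr_inj//|x _]; exists (y + y - x) => //.
by rewrite opprB addrC subrK.
Qed.

Section two_jump_example.
Context (R : realType).

(** For geometric mu the factors mu cancel in the balance equation, which
    becomes h(a,b) + h(b,a) = h(0,a) + h(0,b) with h(a,b) the sum of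
    g^k_(a+k) over 1 <= k <= b.  These rates are the solution
    h(a,b) = min(b,2) of the product condition plus an antisymmetric
    perturbation: 1 for a = 1 and b >= 2, and -1 for a >= 2 and b = 1. *)
Definition two_jump_rates (k n : nat) : R :=
  if k == 1%N then ((n == 1%N) || (n == 2%N))%:R
  else if k == 2%N then (if n == 2%N then 1 else if (2 < n)%N then 2 else 0)
  else 0.

Definition geometric_weights (n : nat) : R := 2^-1 ^+ n.+1.
Local Notation g := two_jump_rates.
Local Notation mu := geometric_weights.

Lemma two_jump_rates_ge0 k n : 0 <= g k n.
Proof.
rewrite /two_jump_rates; case: (k == 1%N) => //.
by case: (k == 2%N) => //; case: (n == 2%N) => //; case: (2 < n)%N.
Qed.

Lemma geometric_weights_ge0 n : 0 <= mu n.
Proof. by rewrite exprn_ge0// invr_ge0. Qed.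

(** Stated as an equation that depends on n only through two tests, so that
    the balance equation reduces to finitely many cases. *)
Lemma two_jump_sum (F : nat -> R) n : (forall k, k != 1%N -> k != 2%N -> F k = 0) ->
  \sum_(k < n.+1) F k = (if (1 <= n)%N then F 1%N else 0) + (if (2 <= n)%N then F 2%N else 0).
Proof.
move=> F0; case: n => [|[|n]].
- by rewrite big_ord1 F0// addr0.
- by rewrite big_ord_recl big_ord1 /= F0// add0r addr0.
rewrite !big_ord_recl /= F0// add0r big1 ?addr0// => i _.
by rewrite F0.
Qed.

Lemma two_jump_mmp : mmp_rates (zrp_rates g).
Proof.
split=> [k n b|n b|k n b]; rewrite /zrp_rates.
- exact: two_jump_rates_ge0.
- by [].
- rewrite /two_jump_rates; case: k => [|[|[|k]]] //=; case: n => [|[|[|n]]] //= [] //.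
Qed.

Lemma two_jump_linear : linear_growth (zrp_rates g).
Proof.
exists 5 => // n b n0; rewrite /zrp_rates.
have -> : \sum_(1 <= k < n.+1) k%:R * g k n = \sum_(k < n.+1) k%:R * g k n.
  by rewrite -(big_mkord xpredT (fun k => k%:R * g k n)) [RHS]big_ltn// mul0r add0r.
rewrite (two_jump_sum n (F := fun k => k%:R * g k n)); last first.
  by move=> [|[|[|k]]] //= _ _; rewrite ?mul0r ?mulr0.
have n1 : 1 <= (n + b)%:R :> R by rewrite ler1n (leq_trans n0)// leq_addr.
have g1 : 0 <= 1%:R * g 1 n <= 1 by rewrite mul1r /two_jump_rates /=; case: (_ || _); rewrite ?ler01 ?lexx.
have g2 : 0 <= 2%:R * g 2 n <= 4.
  by rewrite /two_jump_rates /=; do 2?[case: ifP => _]; apply/andP; split; lra.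
move: g1 g2 => /andP[? ?] /andP[? ?].
by case: ifP => _; case: ifP => _; lra.
Qed.

Lemma two_jump_bounded : bounded_rates (zrp_rates g).
Proof.
exists 3 => // n b; rewrite /zrp_rates big_mkord.
rewrite (two_jump_sum n (F := g^~ n)); last by move=> [|[|[|k]]].
have g1 : 0 <= g 1 n <= 1 by rewrite /two_jump_rates /=; case: (_ || _); rewrite ?ler01 ?lexx.
have g2 : 0 <= g 2 n <= 2.
  by rewrite /two_jump_rates /=; do 2?[case: ifP => _]; apply/andP; split; lra.
move: g1 g2 => /andP[? ?] /andP[? ?].
by case: ifP => _; case: ifP => _; lra.
Qed.

Lemma geometric_probability : probability_weights mu.
Proof.
split; first exact: geometric_weights_ge0.
apply/cvg_lim => //.
rewrite (_ : (fun n => _) = fun n => (1 - 2^-1 ^+ n : R)%:E).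
  apply: cvg_EFin; first exact: nearW.
  rewrite -[X in _ --> X]subr0; apply: cvgB; first exact: cvg_cst.
  by apply: cvg_expr; rewrite ger0_norm ?invr_ge0// invf_lt1// ltr1n.
apply/funext => n; rewrite big_mkord sumEFin; congr (_%:E).
elim: n => [|n IH]; first by rewrite big_ord0 expr0 subrr.
by rewrite big_ord_recr /= IH /geometric_weights exprS; field.
Qed.

Lemma geometric_moment : finite_first_moment mu.
Proof.
apply: (@le_lt_trans _ _ 1%E); last exact: ltry.
apply: lime_le.
  by apply: is_cvg_nneseries => n _ _; rewrite lee_fin mulr_ge0// geometric_weights_ge0.
apply: nearW => n; rewrite big_mkord sumEFin lee_fin.
suff -> : \sum_(i < n) i%:R * mu i = 1 - n.+1%:R * 2^-1 ^+ n.
  by rewrite gerBl mulr_ge0// exprn_ge0// invr_ge0.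
elim: n => [|n IH]; first by rewrite big_ord0 expr0 mulr1 subrr.
by rewrite big_ord_recr /= IH /geometric_weights exprS -[n.+2]addn2 -[n.+1]addn1 !natrD; field.
Qed.

Lemma two_jump_not_product : ~ product_condition g mu.
Proof.
move=> /(_ 2%N 1%N isT isT); rewrite /two_jump_rates /geometric_weights /= !exprS expr0; lra.
Qed.

Lemma two_jump_balance a b :
  inflow mu g a b + inflow mu g b a = outflow mu g a * mu b + outflow mu g b * mu a.
Proof.
have vanish k n (z : R) : k != 1%N -> k != 2%N -> flow mu g k n * z = 0.
  by move=> /negPf k1 /negPf k2; rewrite /flow /two_jump_rates k1 k2 !mul0r.
have vanish' k n : k != 1%N -> k != 2%N -> flow mu g k n = 0.
  by move=> k1 k2; have := vanish k n 1 k1 k2; rewrite mulr1.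
have inE c e : inflow mu g c e =
    (if (1 <= e)%N then flow mu g 1 c * mu (e - 1)%N else 0) +
    (if (2 <= e)%N then flow mu g 2 c * mu (e - 2)%N else 0).
  apply: (two_jump_sum e (F := fun k => flow mu g k c * mu (e - k)%N)) => k; exact: vanish.
have outE c : outflow mu g c =
    (if (1 <= c)%N then flow mu g 1 (c - 1)%N else 0) +
    (if (2 <= c)%N then flow mu g 2 (c - 2)%N else 0).
  apply: (two_jump_sum c (F := fun k => flow mu g k (c - k)%N)) => k; exact: vanish'.
rewrite !inE !outE /flow /two_jump_rates /geometric_weights.
case: a => [|[|[|a]]]; case: b => [|[|[|b]]];
  rewrite /= ?subSS ?subn0 ?add0n ?addn1 ?addn2 /= ?exprS ?expr0; by field.
Qed.

End two_jump_example.

(** * The theorem *)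

Section invariance_criterion.
Context (R : realType) (d : nat).
Variables (p : lattice d -> lattice d -> R) (a : lattice d -> R) (M : R).
Hypothesis p_transition : transition_probability p.
Hypothesis a_weight : admissible_weight p a M.
Variables (g : nat -> nat -> R) (mu : nat -> R) (nu : probability (conf d) R).
Variables (E : set (conf d)) (S : R -> (conf d -> R) -> conf d -> R).
Hypothesis g_rates : mmp_rates (zrp_rates g).
Hypothesis nu_product : product_measure_on_sites nu.
Hypothesis nu_marginal : single_site_marginal nu mu.
Hypothesis standing : standing_assumptions p a (zrp_rates g) mu E S.

Let g_ge0 k n : 0 <= g k n. Proof. by case: g_rates => /(_ k n 0%N). Qed.
Let g_0 n : g 0%N n = 0. Proof. by case: g_rates => _ /(_ n 0%N). Qed.
Let g_small k n : (n < k)%N -> g k n = 0.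
Proof. by case: g_rates => _ _ /(_ k n 0%N) + kn; apply; left. Qed.
Let mu_ge0 := marginal_ge0 nu_marginal.

Let linear_growth_bound : linear_growth (zrp_rates g) ->
  exists2 C : R, 0 < C & forall n, \sum_(k < n.+1) k%:R * g k n <= C * n%:R.
Proof.
move=> [C C0 growth]; exists C => // n.
rewrite -(big_mkord xpredT (fun k => k%:R * g k n)) big_ltn// mul0r add0r.
case: n => [|n]; first by rewrite big_geq// mulr0.
by have := growth n.+1 0%N isT; rewrite addn0.
Qed.

Lemma standing_flow_finite : (\esum_(i in [set: nat * nat]) (flow mu g i.1 i.2)%:E < +oo)%E.
Proof.
case: standing => [[_ _ /linear_growth_bound[C C0 growth] moment]|[_ _ [C C0 bound]]].
  exact: (linear_flow_finite mu_ge0 g_ge0 C0 growth g_0 moment).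
apply: (bounded_flow_finite mu_ge0 g_ge0 C0) => [n|].
  by have := bound n 0%N; rewrite big_mkord.
exact: marginal_sum1 nu_marginal.
Qed.

Lemma invariant_generator : invariant_measure E a S nu <->
  (forall f : conf d -> R, bounded_on setT f -> cylinder f ->
     \int[nu]_eta (generator p (zrp_rates g) f eta)%:E = 0)%E.
Proof.
have [p_ge0 p_row] := p_transition.
case: standing => [[-> S_mmp /linear_growth_bound[C C0 growth] moment]|[-> [D [_ _ _ inv]] _]].
  exact: (lipschitz_invariance p_ge0 p_row a_weight g_ge0 g_small C0 growth
            nu_product nu_marginal moment S_mmp).
exact: inv.
Qed.

End invariance_criterion.

Theorem proposition3p10 (R : realType) (d : nat)
    (p : lattice d -> lattice d -> R) (a : lattice d -> R) (M : R)
    (p_transition : transition_probability p)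
    (p_irreducible : irreducible p)
    (p_translation : translation_invariant_kernel p)
    (a_weight : admissible_weight p a M) :
  (forall (g : nat -> nat -> R) (mu : nat -> R)
      (mubar : probability (conf d) R)
      (E : set (conf d)) (S : R -> (conf d -> R) -> conf d -> R),
    mmp_rates (zrp_rates g) ->
    translation_invariant_measure mubar ->
    product_measure_on_sites mubar ->
    single_site_marginal mubar mu ->
    0 < mu 0%N ->
    standing_assumptions p a (zrp_rates g) mu E S ->
    (asymmetric_kernel p ->
       (invariant_measure E a S mubar <-> product_condition g mu)) /\
    (symmetric_kernel p ->
       product_condition g mu -> invariant_measure E a S mubar)) /\
  (* for symmetric p the condition is not necessary *)
  (symmetric_kernel p ->
    exists (g : nat -> nat -> R) (mu : nat -> R),
      [/\ mmp_rates (zrp_rates g) /\ probability_weights mu /\ 0 < mu 0%N,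
          linear_growth (zrp_rates g) /\ finite_first_moment mu /\
            bounded_rates (zrp_rates g),
          ~ product_condition g mu
        & forall (mubar : probability (conf d) R)
            (E : set (conf d)) (S : R -> (conf d -> R) -> conf d -> R),
            translation_invariant_measure mubar ->
            product_measure_on_sites mubar ->
            single_site_marginal mubar mu ->
            standing_assumptions p a (zrp_rates g) mu E S ->
            invariant_measure E a S mubar]).
Proof.
have [p_ge0 p_row] := p_transition.
have p_col := doubly_stochastic p_transition p_translation.
split.
  move=> g mu nu E S rates _ nu_prod nu_marg mu0 standing.
  have flow_fin := standing_flow_finite rates nu_marg standing.
  have criterion := invariant_generator p_transition a_weight rates nu_prod nu_marg standing.
  have g_ge0 k n : 0 <= g k n by case: rates => /(_ k n 0%N).
  have g_0 n : g 0%N n = 0 by case: rates => _ /(_ n 0%N).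
  have g_small k n : (n < k)%N -> g k n = 0.
    by case: rates => _ _ /(_ k n 0%N) + kn; apply; left.
  have sufficient : product_condition g mu -> invariant_measure E a S nu.
    move=> pc; apply/criterion => f fB cf.
    exact: (product_condition_generator nu_prod nu_marg g_ge0 g_0 g_small p_ge0 p_row p_col
              flow_fin mu0 pc fB cf).
  split=> // asym; split=> // /criterion gen0.
  exact: (generator_product_condition nu_prod nu_marg g_ge0 g_0 g_small p_ge0 p_row p_col
            flow_fin mu0 asym gen0).
move=> psym; exists (@two_jump_rates R), (@geometric_weights R).
split.
- split; [exact: two_jump_mmp|split; first exact: geometric_probability].
  by rewrite exprn_gt0// invr_gt0.
- split; first exact: two_jump_linear.
  by split; [exact: geometric_moment|exact: two_jump_bounded].
- exact: two_jump_not_product.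
move=> nu E S _ nu_prod nu_marg standing.
have rates := two_jump_mmp R.
have flow_fin := standing_flow_finite rates nu_marg standing.
apply/(invariant_generator p_transition a_weight rates nu_prod nu_marg standing) => f fB cf.
apply: (balance_generator nu_prod nu_marg _ _ _ p_ge0 p_row p_col flow_fin psym) => //.
- exact: two_jump_rates_ge0.
- by case: rates => _ _ small k n kn; apply: (small k n 0%N); left.
- exact: two_jump_balance.
Qed.
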